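(* Let $H$ and $G$ be real Hilbert spaces, let $L:H\to G$ be a nonzero bounded linear operator, and let $C$ and $Q$ be nonempty closed convex subsets of $H$ and $G$, respectively. Put $\beta=1/\|L\|^2$. Let $\Omega$ be the solution set of the split feasibility problem: find $x\in C$ such that $Lx\in Q$; assume $\Omega\ne\emptyset$. Let $\alpha>0$, $\{\eta_k\}_{k\in\mathbb N}\in\ell^1_+(\mathbb N)$ and $\{U_k\}_{k\in\mathbb N}\subset\mathcal P_\alpha(H)$ be such that $\mu:=\sup_{k\in\mathbb N}\|U_k\|<+\infty$ and $(1+\eta_k)U_{k+1}\succeq U_k$ for all $k\in\mathbb N$. Let $\gamma_k\in(0,\frac{2\beta}{\|U_k\|})$ and $\lambda_k\in(0,\frac1{\alpha_k})$, where $\alpha_k=\frac{2\beta}{4\beta-\gamma_k\|U_k\|}$, for all $k\in\mathbb N$. Let $\{a_k\},\{b_k\}$ be sequences in $H$ with $\sum_{k=0}^{+\infty}\lambda_k\|a_k\|<+\infty$ and $\sum_{k=0}^{+\infty}\lambda_k\|b_k\|<+\infty$. Assume moreover that at least one of the following two sets of conditions holds, where $\underline\lambda,\tau,\underline\gamma,\epsilon$ are constants and the inequalities hold for all $k$: (A) $0<\underline\lambda\le\lambda_k\le\frac1{\alpha_k}-\tau$ with $\tau\in(0,\frac1{\alpha_k}-\underline\lambda)$; and $0<\underline\gamma\le\gamma_k\le\frac{2\beta-\epsilon}{\mu}$ with $\epsilon\in(0,2\beta-\mu\underline\gamma)$. (B) $\sum_{k=0}^{+\infty}\lambda_k(\frac1{\alpha_k}-\lambda_k)=+\infty$;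 $0<\underline\gamma\le\gamma_k\le\frac{2\beta-\epsilon}{\mu}$ with $\epsilon\in(0,2\beta-\mu\underline\gamma)$; $\sum_{k=0}^{+\infty}|\gamma_{k+1}-\gamma_k|<+\infty$, $\sum_{k=0}^{+\infty}\big|\gamma_{k+1}\|U_{k+1}\|-\gamma_k\|U_k\|\big|<+\infty$, and $\sum_{k=0}^{+\infty}\|U_k^{-1}x-U_{k+1}^{-1}x\|<+\infty$ for any $x\in H$; and $\lambda_k\ge\underline\lambda>0$. Let $x_0\in H$ and, for $k\in\mathbb N$, set $$y_k=x_k-\gamma_kU_k\big(L^*(Lx_k-P_Q(Lx_k))+b_k\big),\qquad x_{k+1}=x_k+\lambda_k\big(P_C^{U_k^{-1}}(y_k)+a_k-x_k\big).$$ Then the following hold: (i) For any $x^*\in\Omega$, $\lim_{k\to+\infty}\|x_k-x^*\|_{U_k^{-1}}$ exists; (ii) $\lim_{k\to+\infty}\|x_k-P_C^{U_k^{-1}}(x_k-\gamma_kU_kL^*(Lx_k-P_Q(Lx_k)))\|=0$; (iii) $\{x_k\}$ converges weakly to a point in $\Omega$; (iv) $L^*(Lx_k-P_Q(Lx_k))\to L^*(Lx^*-P_Q(Lx^* ))$ strongly as $k\to+\infty$, where $x^*\in\Omega$.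
   Context: $\mathbb N$ is the set of nonnegative integers, and $\ell^1_+(\mathbb N)$ is the set of summable sequences in $[0,+\infty)$. $L^*$ is the adjoint of $L$, and $P_Q$ is the metric projection of $G$ onto $Q$. For bounded self-adjoint linear operators $U,V$ on $H$, $U\succeq V$ means $\langle Ux,x\rangle\ge\langle Vx,x\rangle$ for all $x\in H$; $\mathcal P_\alpha(H)$ is the set of bounded self-adjoint linear operators $U$ on $H$ with $U\succeq\alpha I$. $\|U\|$ is the operator norm. For $U\in\mathcal P_\alpha(H)$ with $\alpha>0$, $\|x\|_{U^{-1}}=\sqrt{\langle U^{-1}x,x\rangle}$, and $P_C^{U^{-1}}(x)=\arg\min_{y\in C}\|x-y\|_{U^{-1}}$ is the projector onto $C$ relative to the norm $\|\cdot\|_{U^{-1}}$. *)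

(* Defs.v *)
From HB Require Import structures.
From mathcomp Require Import all_boot all_order all_algebra.
From mathcomp Require Import all_classical all_reals all_analysis.

Set Implicit Arguments.
Unset Strict Implicit.
Unset Printing Implicit Defensive.

Import Order.TTheory GRing.Theory Num.Theory.
Import numFieldNormedType.Exports.

Local Open Scope classical_set_scope.
Local Open Scope ring_scope.

(* A real Hilbert space: a complete normed module over a model R of the real
   numbers, whose norm comes from a symmetric bilinear form. *)
HB.mixin Record CompleteNormedModule_isHilbert (R : realType) V
    & CompleteNormedModule R V := {
  inner : V -> V -> R;
  innerC : forall x y, inner x y = inner y x;
  innerDl : forall x y z, inner (x + y) z = inner x z + inner y z;
  innerZl : forall (a : R) x y, inner (a *: x) y = a * inner x y;
  innerxx : forall x, inner x x = `|x| ^+ 2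
}.

#[short(type="hilbertType")]
HB.structure Definition Hilbert (R : realType) :=
  {V of CompleteNormedModule_isHilbert R V & CompleteNormedModule R V}.

Section Operators.
Context {R : realType}.

(* Junk value 0 when f is unbounded on the unit ball. *)
Definition op_norm (V W : normedModType R) (f : V -> W) : R :=
  sup [set `|f x| | x in [set x | `|x| <= 1]].

(* [get] picks the unique z with the stated property, which exists (Riesz) when
   f is linear and bounded. *)
Definition adjoint (H G : hilbertType R) (f : H -> G) (y : G) : H :=
  get [set z | forall x, inner (f x) y = inner x z].

Definition self_adjoint (H : hilbertType R) (U : H -> H) : Prop :=
  forall x y, inner (U x) y = inner x (U y).

(* loewner_le V U is "U \succeq V". *)
Definition loewner_le (H : hilbertType R) (V U : H -> H) : Prop :=
  forall x, inner (V x) x <= inner (U x) x.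

Definition posop (H : hilbertType R) (alpha : R) : set {linear H -> H} :=
  [set U | [/\ bounded_fun_norm U, self_adjoint U
             & loewner_le (fun x => alpha *: x) U]].

(* The two-sided inverse of U when U is bijective, as is every U in
   posop alpha with alpha > 0 (Lax-Milgram). *)
Definition op_inv (H : hilbertType R) (U : H -> H) : H -> H := pinv [set: H] U.

Definition norm_inv (H : hilbertType R) (U : H -> H) (x : H) : R :=
  Num.sqrt (inner (op_inv U x) x).

(* The minimizer over y in C of N (x - y), for a norm N on V. *)
Definition metric_proj (V : normedModType R) (N : V -> R) (C : set V) (x : V) : V :=
  get [set y | C y /\ forall z, C z -> N (x - y) <= N (x - z)].

Definition weak_cvg (H : hilbertType R) (u : nat -> H) (l : H) : Prop :=
  forall y, inner (u k) y @[k --> \oo] --> inner l y.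

Definition l1_plus : set (nat -> R) :=
  [set u | (forall k, 0 <= u k) /\
           (\sum_(0 <= k <oo) (u k)%:E < +oo :> \bar R)%E].

(* Solutions of the split feasibility problem. *)
Definition sfp (H G : hilbertType R) (L : H -> G) (C : set H) (Q : set G) :
  set H := [set x | C x /\ Q (L x)].

Definition sfp_grad (H G : hilbertType R) (L : H -> G) (Q : set G) (x : H) : H :=
  adjoint L (L x - metric_proj Num.norm Q (L x)).

End Operators.

(* Main.v *)
Require Import Defs.
From HB Require Import structures.
From mathcomp Require Import all_boot all_order all_algebra.
From mathcomp Require Import all_classical all_reals all_analysis.
From mathcomp Require Import ring lra.

Set Implicit Arguments.
Unset Strict Implicit.
Unset Printing Implicit Defensive.

Import Order.TTheory GRing.Theory Num.Theory.
Import numFieldNormedType.Exports.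

Local Open Scope classical_set_scope.
Local Open Scope ring_scope.

(** Write [B_k u v = <U_k^-1 u, v>], [N_k] for its norm, [T_k x] for the projection of
    [x - gamma_k U_k (grad x)] onto [C] relative to [N_k], where [grad] is [sfp_grad L Q], and
    [kap_k = gamma_k ||U_k|| / beta].  With this ratio, [1 / alpha_k = 2 - kap_k / 2].

    One step.  Fix a solution [xs] and put [X = x - xs], [D = gamma U (grad x)] (the gradient
    displacement) and [E = x - D - T x] (the projection displacement), so that
    [x - T x = D + E].  Expanding the square in [B] shows that the step
    [x + lambda (T x - x)] decreases the squared distance to [xs] by at least [2 lambda gap],
    where [gap] is the sum of [B D X - B D D / kap], which is nonnegative because the gradient
    is cocoercive, of [B E (T x - xs)], which is nonnegative because projections make obtuse
    angles, and of [B W W / (4 kap)] with [W = (2 - kap) D - kap E] ([relaxed_step_gap]).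
    Since [lambda] may come arbitrarily close to [1 / alpha], the displacement [D + E] itself
    is not controlled in this way.  It is controlled by a second identity
    ([step_alignment]).  When [gap] is small, [E] is almost parallel to [D], so that
    [B D (T x - xs)] is small along with [B E (T x - xs)]; this forces [B D X] to be about
    [2 B D D / kap], whereas a small [gap] makes it about [B D D / kap].  Hence [B D D] is
    small, and so are the residual [|L x - P_Q (L x)|^2] and [D + E].  This is made
    quantitative in [sfp_step_estimates].

    The sequence.  The metrics satisfy [N_(k+1)^2 <= (1 + eta_k) N_k^2] ([inv_form_antitone]),
    and the perturbations [a_k], [b_k] change the iterate by a summable amount, so the distances
    [N_k (x_k - xs)] form a quasi-Fejer sequence: they converge and [gap_k] tends to 0
    ([quasi_fejer_gap]).  This gives (i), and with the one-step estimates (ii) and (iv).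

    Weak convergence is Opial's argument in a variable metric ([variable_metric_opial]).
    Bounded sequences have weak limits along ultrafilters by the Riesz theorem; such limits
    of the iterates are solutions, as closed convex sets are weakly closed.  The operators
    [U_k^-1] converge pointwise, being decreasing up to convergent factors
    ([antitone_form_cvg]), so two such limits [p] and [q] can be compared through the
    convergent quantities [N_k (x_k - p)^2 - N_k (x_k - q)^2], and they coincide. *)

(** * Semi-inner products *)

(** Definiteness is left out, so that differences of ordered forms and the forms of positive
    operators share one theory of the Cauchy-Schwarz inequality. *)
Record semi_inner (R : realType) (V : lmodType R) (B : V -> V -> R) : Prop :=
  SemiInner {
    formC : forall x y, B x y = B y x;
    formDl : forall x y z, B (x + y) z = B x z + B y z;
    formZl : forall (a : R) x y, B (a *: x) y = a * B x y;
    form_ge0 : forall x, 0 <= B x x }.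

Section SemiInner.
Context {R : realType} {V : lmodType R} {B : V -> V -> R}.
Hypothesis fB : semi_inner B.

Lemma formDr x y z : B x (y + z) = B x y + B x z.
Proof. by rewrite formC // formDl // !(formC fB x). Qed.

Lemma formZr (a : R) x y : B x (a *: y) = a * B x y.
Proof. by rewrite formC // formZl // (formC fB x). Qed.

Lemma formNl x y : B (- x) y = - B x y.
Proof. by rewrite -scaleN1r formZl // mulN1r. Qed.

Lemma formNr x y : B x (- y) = - B x y.
Proof. by rewrite -scaleN1r formZr mulN1r. Qed.

Lemma form0l y : B 0 y = 0.
Proof. by rewrite -(scale0r (0 : V)) formZl // mul0r. Qed.

Lemma form0r y : B y 0 = 0.
Proof. by rewrite -(scale0r (0 : V)) formZr mul0r. Qed.

Definition formE :=
  (formDl fB, formDr, formZl fB, formZr, formNl, formNr, form0l, form0r).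

Lemma form_cauchy_schwarz x y : B x y ^+ 2 <= B x x * B y y.
Proof.
have quad t : 0 <= B x x + t * (B x y *+ 2) + t ^+ 2 * B y y.
  have := form_ge0 fB (x + t *: y).
  rewrite !formE (formC fB y x) => h; apply: le_trans h _.
  by rewrite le_eqVlt; apply/orP; left; apply/eqP; ring.
have := form_ge0 fB y; rewrite le_eqVlt => /predU1P[y0|y_gt0].
  rewrite -y0 mulr0; have [->|xy0] := eqVneq (B x y) 0; first by rewrite expr0n.
  (* the quadratic polynomial is affine, so nonnegativity forces slope 0 *)
  have := quad (- (B x x + 1) / (B x y *+ 2)).
  rewrite -y0 mulr0 addr0 divfK; last by rewrite mulrn_eq0.
  by move=> ?; lra.
have := quad (- B x y / B y y).
have -> : B x x + - B x y / B y y * (B x y *+ 2) + (- B x y / B y y) ^+ 2 * B y y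
   = (B x x * B y y - B x y ^+ 2) / B y y by field; rewrite gt_eqF.
by rewrite pmulr_lge0 ?invr_gt0// subr_ge0.
Qed.

Definition form_norm x := Num.sqrt (B x x).

Lemma form_norm_ge0 x : 0 <= form_norm x.
Proof. exact: sqrtr_ge0. Qed.

Lemma sqr_form_norm x : form_norm x ^+ 2 = B x x.
Proof. by rewrite sqr_sqrtr// form_ge0. Qed.

Lemma form_norm_le x y : (form_norm x <= form_norm y) = (B x x <= B y y).
Proof. by rewrite /form_norm ler_sqrt// form_ge0. Qed.

Lemma form_le_norm x y : `|B x y| <= form_norm x * form_norm y.
Proof.
rewrite -sqrtr_sqr /form_norm -sqrtrM ?form_ge0// ler_sqrt.
  exact: form_cauchy_schwarz.
by rewrite mulr_ge0 ?form_ge0.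
Qed.

Lemma form_normD x y : form_norm (x + y) <= form_norm x + form_norm y.
Proof.
rewrite -(@ler_pXn2r _ 2) ?nnegrE ?addr_ge0 ?form_norm_ge0// sqr_form_norm.
have := form_le_norm x y; rewrite !formE (formC fB y x) => /(le_trans (ler_norm _)).
have := sqr_form_norm x; have := sqr_form_norm y.
move: (form_norm x) (form_norm y) => u v <- <-; nra.
Qed.

Lemma form_normZ (a : R) x : form_norm (a *: x) = `|a| * form_norm x.
Proof. by rewrite /form_norm !formE mulrA -expr2 sqrtrM ?sqr_ge0// sqrtr_sqr. Qed.

Lemma form_normN x : form_norm (- x) = form_norm x.
Proof. by rewrite -scaleN1r form_normZ normrN normr1 mul1r. Qed.

(** The law of cosines at a vertex [y] with an obtuse angle, as when [y] is a projection
    of [x] onto a convex set containing [z]. *)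
Lemma form_obtuse_le x y z : 0 <= B (x - y) (y - z) ->
  B (y - z) (y - z) + B (x - y) (x - y) <= B (x - z) (x - z).
Proof.
have -> : x - z = (x - y) + (y - z) by rewrite addrA subrK.
move: (x - y) (y - z) => u v; rewrite !formE (formC fB v u); lra.
Qed.

End SemiInner.
Arguments form_norm {R V} B x.

Lemma semi_inner_inner (R : realType) (H : hilbertType R) :
  semi_inner (@inner R H).
Proof.
by split; [exact: innerC|exact: innerDl|exact: innerZl|move=> x; rewrite innerxx].
Qed.

Lemma inner_le_norm (R : realType) (H : hilbertType R) (x y : H) :
  `|inner x y| <= `|x| * `|y|.
Proof.
have := form_le_norm (semi_inner_inner H) x y.
by rewrite /form_norm !innerxx !sqrtr_sqr !normr_id.
Qed.

(** * Minimization over closed convex sets *)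

(** This is the shape of the Cauchy estimates coming from the parallelogram identity, and from
    Cauchy-Schwarz for a monotone family of forms. *)
Lemma sqr_cauchy_is_cvgn (R : realType) (V : completeNormedModType R)
    (u : nat -> V) (w : nat -> R) :
  w @ \oo --> (0 : R) ->
  (forall i j, `|u i - u j| ^+ 2 <= w i + w j) -> cvgn u.
Proof.
move=> w0 uw; apply/cauchy_cvgP/cauchy_exP => _/posnumP[e].
have e2 : 0 < e%:num ^+ 2 / 2 :> R by [].
have /cvgrPdist_lt/(_ _ e2)[N _ Nw] := w0.
have wN n : (N <= n)%N -> w n < e%:num ^+ 2 / 2.
  by move=> /Nw /=; rewrite sub0r normrN => /(le_lt_trans (ler_norm _)).
exists (u N); exists N => // n /= Nn.
rewrite -ball_normE /= -(@ltr_pXn2r _ 2) ?nnegrE//.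
by apply: le_lt_trans (uw _ _) _; have := wN _ (leqnn N); have := wN _ Nn; lra.
Qed.

Section Elliptic.
Context {R : realType} {H : hilbertType R} (B : H -> H -> R) (m M : R).
Hypotheses (fB : semi_inner B) (m_gt0 : 0 < m)
  (B_ge : forall x, m * `|x| ^+ 2 <= B x x)
  (B_le : forall x, B x x <= M * `|x| ^+ 2).

Lemma elliptic_form_le x y : `|B x y| <= `|M| * `|x| * `|y|.
Proof.
rewrite -(@ler_pXn2r _ 2) ?nnegrE ?mulr_ge0// real_normK ?num_real//.
apply: le_trans (form_cauchy_schwarz fB _ _) _.
have -> : (`|M| * `|x| * `|y|) ^+ 2 = (`|M| * `|x| ^+2) * (`|M| * `|y| ^+ 2) by ring.
by rewrite ler_pM ?form_ge0//; (apply: le_trans (B_le _) _);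
  rewrite ler_wpM2r ?sqr_ge0 ?ler_norm.
Qed.

(** The minimizer of [B z z - 2 phi z] over [C]: minimizing sequences are Cauchy by the
    parallelogram identity.  Taking for [C] the whole space gives the representation of [phi]
    by [B], and taking [phi = B x] gives the projection of [x] onto [C]. *)
Lemma elliptic_variational (phi : H -> R) (K : R) (C : set H) :
  (forall x y, phi (x + y) = phi x + phi y) ->
  (forall (a : R) x, phi (a *: x) = a * phi x) ->
  (forall x, `|phi x| <= K * `|x|) ->
  C !=set0 -> closed C -> convex_set C ->
  exists2 p, C p & forall c, C c -> 0 <= B p (c - p) - phi (c - p).
Proof.
move=> phiD phiZ phiK [c0 Cc0] Ccl Ccv.
have phiN x : phi (- x) = - phi x by rewrite -scaleN1r phiZ mulN1r.
pose J z := B z z - phi z *+ 2.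
have Cseg t u v : 0 <= t <= 1 -> C u -> C v -> C (u + t *: (v - u)).
  case/andP=> t0 t1 Cu Cv.
  have := @Ccv v u (Itv01 t0 t1); rewrite !inE => /(_ Cv Cu).
  suff -> : u + t *: (v - u) = t *: v + (1 - t) *: u by [].
  rewrite scalerBr scalerBl scale1r addrCA; congr (_ + _).
have Jlow z : - (K ^+ 2 / m) <= J z.
  have Kz : phi z <= K * `|z| by apply: le_trans (phiK z); exact: ler_norm.
  have : 0 <= m * (`|z| - K / m) ^+ 2 by rewrite mulr_ge0 ?sqr_ge0 ?ltW.
  have -> : m * (`|z| - K / m) ^+ 2 = m * `|z| ^+ 2 - K * `|z| *+ 2 + K ^+ 2 / m
    by field; rewrite gt_eqF.
  by have := B_ge z; rewrite /J; lra.
have Jinf : has_inf (J @` C).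
  split; first by exists (J c0), c0.
  by exists (- (K ^+ 2 / m)) => _ [z _ <-].
pose d := inf (J @` C).
have dJ c : C c -> d <= J c by move=> Cc; apply: ge_inf; [exact: Jinf.2|exists c].
have minseq n : exists z, C z /\ J z < d + n.+1%:R^-1.
  have n0 : 0 < n.+1%:R^-1 :> R by [].
  by have [_ [z Cz <-] Jz] := inf_adherent n0 Jinf; exists z.
have /choice[u uP] := minseq.
have half01 : 0 <= (2^-1 : R) <= 1. apply/andP; split; lra.
have ucvg : cvgn u.
  apply: (@sqr_cauchy_is_cvgn _ _ _ (fun n => 2 / m * n.+1%:R^-1)).
    by rewrite -[X in _ --> X](mulr0 (2 / m)); apply: cvgM; [exact: cvg_cst|exact: cvg_harmonic].
  move=> i j; have [[Ci Ji] [Cj Jj]] := (uP i, uP j).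
  have := dJ _ (Cseg _ _ _ half01 Ci Cj).
  have par : 4 * J (u i + 2^-1 *: (u j - u i)) =
     2 * J (u i) + 2 * J (u j) - B (u i - u j) (u i - u j).
    rewrite /J !phiD phiZ phiD phiN !(formE fB) (formC fB (u j) (u i)); by field.
  rewrite -mulrDr => dmid; have := B_ge (u i - u j).
  rewrite mulrAC ler_pdivlMr// [_ * m]mulrC.
  move: (i.+1%:R^-1) (j.+1%:R^-1) Ji Jj => ei ej Ji Jj; lra.
pose p := lim (u @ \oo).
have up : u @ \oo --> p by exact: ucvg.
have Cp : C p by apply: (closed_cvg C Ccl _ _ up); apply: nearW => n; case: (uP n).
have Jp : J p <= d.
  pose c := 2 * (`|M| * `|p| + K).
  have JpE n : J p <= d + n.+1%:R^-1 + c * `|p - u n|.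
    have [_ Jn] := uP n.
    have -> : J p = J (u n) + B (p - u n) p *+ 2 - B (p - u n) (p - u n)
                    - phi (p - u n) *+ 2.
      by rewrite /J phiD phiN !(formE fB) (formC fB (u n) p); ring.
    have h0 := form_ge0 fB (p - u n).
    have h1 := le_trans (ler_norm _) (elliptic_form_le (p - u n) p).
    have : - phi (p - u n) <= K * `|p - u n|.
      by apply: le_trans (phiK _); rewrite -normrN ler_norm.
    move: n.+1%:R^-1 Jn => en Jn h2; rewrite /c; lra.
  have lim_d : d + n.+1%:R^-1 + c * `|p - u n| @[n --> \oo] --> d + 0 + c * 0.
    apply: cvgD; first by apply: cvgD; [exact: cvg_cst|exact: cvg_harmonic].
    apply: cvgM; [exact: cvg_cst|]; rewrite -(@normr0 _ H) -(subrr p).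
    by apply: cvg_norm; apply: cvgB; [exact: cvg_cst|exact: up].
  rewrite mulr0 !addr0 in lim_d.
  by apply: (ler_cvg_to (cvg_cst (J p)) lim_d); apply: nearW.
exists p => // c Cc.
set A := B p _ - _; rewrite leNgt; apply/negP => A0.
have b0 := form_ge0 fB (c - p).
(* a short enough step from p towards c would decrease J *)
pose t := - A / (B (c - p) (c - p) + 1 - A).
have den0 : 0 < B (c - p) (c - p) + 1 - A by lra.
have t0 : 0 < t by rewrite divr_gt0// oppr_gt0.
have tE : t * (B (c - p) (c - p) + 1 - A) = - A by rewrite divfK ?gt_eqF.
have t1 : t <= 1 by rewrite ler_pdivrMr// mul1r; lra.
have := dJ _ (Cseg t p c _ Cp Cc); rewrite (ltW t0) t1 => /(_ isT).
have -> : J (p + t *: (c - p)) = J p + t * (A *+ 2 + t * B (c - p) (c - p)).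
  by rewrite /J /A phiD phiZ !(formE fB) (formC fB c p); ring.
apply/negP; rewrite -ltNge; nra.
Qed.
End Elliptic.

(** * Projections and representation theorems *)

Section EllipticProjection.
Context {R : realType} {H : hilbertType R} (B : H -> H -> R) (m M : R).
Hypotheses (fB : semi_inner B) (m_gt0 : 0 < m)
  (B_ge : forall x, m * `|x| ^+ 2 <= B x x)
  (B_le : forall x, B x x <= M * `|x| ^+ 2).

Lemma elliptic_representation (phi : H -> R) (K : R) :
  (forall x y, phi (x + y) = phi x + phi y) ->
  (forall (a : R) x, phi (a *: x) = a * phi x) ->
  (forall x, `|phi x| <= K * `|x|) ->
  exists p, forall v, B p v = phi v.
Proof.
move=> phiD phiZ phiK.
have [||v u t _ _|p _ pP] := elliptic_variational fB m_gt0 B_ge B_le phiD phiZ phiK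
    (C := setT).
- by exists 0.
- exact: closedT.
- by rewrite inE.
exists p => v; apply/eqP; rewrite eq_le.
have := pP (p + v) I; have := pP (p - v) I.
have phiN : phi (- v) = - phi v by rewrite -scaleN1r phiZ mulN1r.
rewrite addrAC subrr add0r [p + v]addrC addrK (formNr fB) phiN.
by move=> h1 h2; apply/andP; split; lra.
Qed.

(** The variational inequality holds at one minimizer by [elliptic_variational]; it makes that
    minimizer unique, so it holds at whichever minimizer is chosen. *)
Lemma metric_proj_variational (C : set H) (x : H) :
  C !=set0 -> closed C -> convex_set C ->
  let p := metric_proj (form_norm B) C x in
  C p /\ forall c, C c -> 0 <= B (x - p) (p - c).
Proof.
move=> C0 Ccl Ccv; rewrite /metric_proj; cbv zeta.
have [q Cq qP] := elliptic_variational fB m_gt0 B_ge B_le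
  (formDr fB x) (fun a => formZr fB a x) (elliptic_form_le fB B_le x) C0 Ccl Ccv.
have {}qP c : C c -> 0 <= B (x - q) (q - c).
  by move=> /qP; rewrite -(opprB q c) !(formE fB) opprK; lra.
have qmin c : C c -> B (q - c) (q - c) + B (x - q) (x - q) <= B (x - c) (x - c).
  by move=> /qP; exact: form_obtuse_le.
case: xgetP => [p _ [Cp pP]|].
  have -> : p = q; last by [].
  have := pP _ Cq; rewrite form_norm_le// => pq.
  have pq0 : `|q - p| ^+ 2 = 0.
    apply/eqP; rewrite eq_le sqr_ge0 andbT -(pmulr_rle0 _ m_gt0).
    by have := qmin _ Cp; have := B_ge (q - p); lra.
  by apply/esym/eqP; rewrite -subr_eq0 -normr_eq0 -sqrf_eq0 pq0.
move=> /(_ q) []; split=> // c Cc; rewrite form_norm_le//.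
by have := qmin _ Cc; have := form_ge0 fB (q - c); lra.
Qed.

Lemma metric_proj_nonexpansive (C : set H) (x y : H) :
  C !=set0 -> closed C -> convex_set C ->
  form_norm B (metric_proj (form_norm B) C x - metric_proj (form_norm B) C y)
    <= form_norm B (x - y).
Proof.
move=> C0 Ccl Ccv; rewrite form_norm_le//.
have [] := metric_proj_variational x C0 Ccl Ccv.
have [] := metric_proj_variational y C0 Ccl Ccv.
set q := metric_proj _ _ y; set p := metric_proj _ _ x.
move=> Cq qP Cp pP; have hp := pP _ Cq; have hq := qP _ Cp.
have -> : x - y = (p - q) + ((x - p) - (y - q)).
  by rewrite -{1}(subrK p x) -{1}(subrK q y) opprD addrACA addrC.
have h0 := form_ge0 fB ((x - p) - (y - q)).
move: hp hq h0; rewrite -(opprB p q).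
move: (p - q) (x - p) (y - q) => w u v hp hq h0.
have -> : B (w + (u - v)) (w + (u - v)) =
  B w w + B (u - v) (u - v) + (B u w + B v (- w)) *+ 2.
  by rewrite !(formE fB) (formC fB w u) (formC fB w v); ring.
lra.
Qed.

End EllipticProjection.

Section HilbertProjection.
Context {R : realType} {H : hilbertType R}.

Lemma inner_norm_fun : form_norm (@inner R H) = Num.norm.
Proof. by apply/funext => x; rewrite /form_norm innerxx sqrtr_sqr normr_id. Qed.

Lemma inner_ge_sqr (x : H) : 1 * `|x| ^+ 2 <= inner x x.
Proof. by rewrite innerxx mul1r. Qed.

Lemma inner_le_sqr (x : H) : inner x x <= 1 * `|x| ^+ 2.
Proof. by rewrite innerxx mul1r. Qed.

Lemma norm_proj_variational (C : set H) (x : H) :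
  C !=set0 -> closed C -> convex_set C ->
  let p := metric_proj Num.norm C x in
  C p /\ forall c, C c -> 0 <= inner (x - p) (p - c).
Proof.
have := metric_proj_variational (semi_inner_inner H) ltr01 inner_ge_sqr inner_le_sqr
  (C := C) x.
by rewrite inner_norm_fun.
Qed.

Lemma riesz (phi : H -> R) (K : R) :
  (forall x y, phi (x + y) = phi x + phi y) ->
  (forall (a : R) x, phi (a *: x) = a * phi x) ->
  (forall x, `|phi x| <= K * `|x|) ->
  exists p, forall v, inner p v = phi v.
Proof.
exact: (elliptic_representation (semi_inner_inner H) ltr01 inner_ge_sqr inner_le_sqr).
Qed.

Lemma inner_inj (x y : H) : (forall v, inner x v = inner y v) -> x = y.
Proof.
move=> xy; apply/eqP; rewrite -subr_eq0 -normr_eq0 -sqrf_eq0 -innerxx.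
have iH := semi_inner_inner H.
by rewrite (formDl iH) (formNl iH) xy subrr.
Qed.

End HilbertProjection.

(** * Bounded operators and adjoints *)

Section BoundedOperators.
Context {R : realType}.

Lemma le_op_norm (V W : normedModType R) (f : {linear V -> W}) x :
  bounded_fun_norm f -> `|f x| <= op_norm f * `|x|.
Proof.
move=> /(_ 1)[K fK].
have fsup y : `|y| <= 1 -> `|f y| <= op_norm f.
  move=> y1; apply: ub_le_sup; last by exists y.
  by exists K => _ [z /= z1 <-]; exact: fK.
have [->|x0] := eqVneq x 0; first by rewrite linear0 !normr0 mulr0.
have nx : 0 < `|x| by rewrite normr_gt0.
have := fsup (`|x|^-1 *: x); rewrite linearZ !normrZ normfV normr_id mulVf ?gt_eqF//.
by move=> /(_ (lexx _)); rewrite ler_pdivrMl// mulrC.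
Qed.

Lemma op_norm_ge0 (V W : normedModType R) (f : {linear V -> W}) :
  bounded_fun_norm f -> 0 <= op_norm f.
Proof.
move=> /(_ 1)[K fK]; apply: (@le_trans _ _ `|f 0|) => //.
apply: ub_le_sup; last by exists 0 => //=; rewrite normr0.
by exists K => _ [z /= z1 <-]; exact: fK.
Qed.

Lemma adjointP (H G : hilbertType R) (f : {linear H -> G}) x y :
  bounded_fun_norm f -> inner (f x) y = inner x (adjoint f y).
Proof.
move=> bf; move: x; rewrite /adjoint; case: xgetP => [z _ //|].
have iG := semi_inner_inner G.
have [|||p pP] := @riesz R H (fun x => inner (f x) y) (op_norm f * `|y|).
- by move=> u v; rewrite linearD innerDl.
- by move=> a u; rewrite linearZ innerZl.
- move=> u; apply: le_trans (inner_le_norm _ _) _.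
  by rewrite mulrAC ler_wpM2r// le_op_norm.
by move=> /(_ p) []; move=> x; rewrite -pP innerC.
Qed.

Lemma adjoint_norm_le (H G : hilbertType R) (f : {linear H -> G}) y :
  bounded_fun_norm f -> `|adjoint f y| <= op_norm f * `|y|.
Proof.
move=> bf; have [->|z0] := eqVneq (adjoint f y) 0.
  by rewrite normr0 mulr_ge0// op_norm_ge0.
have nz : 0 < `|adjoint f y| by rewrite normr_gt0.
rewrite -(ler_pM2l nz) -expr2 -innerxx -adjointP//.
apply: le_trans (ler_norm _) _; apply: le_trans (inner_le_norm _ _) _.
by rewrite mulrA ler_wpM2r// mulrC le_op_norm.
Qed.

Lemma adjoint0 (H G : hilbertType R) (f : {linear H -> G}) :
  bounded_fun_norm f -> adjoint f 0 = 0.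
Proof.
move=> bf; apply/eqP; rewrite -normr_le0.
by have := adjoint_norm_le 0 bf; rewrite normr0 mulr0.
Qed.

End BoundedOperators.

(** * Positive operators and their inverse forms *)

Section PositiveOperators.
Context {R : realType} {H : hilbertType R}.

Definition inv_form (U : H -> H) (x y : H) : R := inner (op_inv U x) y.

Lemma semi_inner_posop (alpha : R) (U : {linear H -> H}) :
  0 <= alpha -> posop alpha U -> semi_inner (fun x y => inner (U x) y).
Proof.
move=> a0 [_ sU aU]; split=> [x y|x y z|a x y|x].
- by rewrite sU innerC.
- by rewrite linearD innerDl.
- by rewrite linearZ innerZl.
- by apply: le_trans (aU x); rewrite innerZl innerxx mulr_ge0 ?sqr_ge0.
Qed.

Section OnePositiveOperator.
Context (alpha : R) (U : {linear H -> H}).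
Hypotheses (alpha_gt0 : 0 < alpha) (U_pos : posop alpha U).

Lemma posop_bounded : bounded_fun_norm U. Proof. by have [] := U_pos. Qed.

Lemma posop_ge x : alpha * `|x| ^+ 2 <= inner (U x) x.
Proof. by have [_ _ /(_ x)] := U_pos; rewrite innerZl innerxx. Qed.

Lemma posop_le x : inner (U x) x <= op_norm U * `|x| ^+ 2.
Proof.
apply: le_trans (ler_norm _) _; apply: le_trans (inner_le_norm _ _) _.
by rewrite expr2 mulrA ler_wpM2r// le_op_norm//; exact: posop_bounded.
Qed.

Lemma op_invK x : U (op_inv U x) = x.
Proof.
suff [p _ <-] : (U @` setT) x by apply: pinvK; rewrite inE; exists p.
have [|||p pP] := elliptic_representation
  (semi_inner_posop (ltW alpha_gt0) U_pos) alpha_gt0 posop_ge posop_le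
  (phi := fun v => inner x v) (K := `|x|).
- by move=> u v; rewrite (formDr (semi_inner_inner H)).
- by move=> a v; rewrite (formZr (semi_inner_inner H)).
- by move=> v; exact: inner_le_norm.
by exists p => //; exact: inner_inj.
Qed.

Lemma posop_inj x y : U x = U y -> x = y.
Proof.
move=> xy; apply/eqP; rewrite -subr_eq0 -normr_eq0 -sqrf_eq0.
rewrite eq_le sqr_ge0 andbT -(pmulr_rle0 _ alpha_gt0).
apply: le_trans (posop_ge _) _.
by rewrite linearB xy subrr (form0l (semi_inner_inner H)).
Qed.

Lemma op_inv_linearK x : op_inv U (U x) = x.
Proof. by apply: posop_inj; rewrite op_invK. Qed.

Lemma semi_inner_inv_form : semi_inner (inv_form U).
Proof.
have [_ sU _] := U_pos.
split=> [x y|x y z|a x y|x]; rewrite /inv_form.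
- by rewrite -{1}(op_invK y) -sU op_invK innerC.
- by rewrite -innerDl; congr inner; apply: posop_inj; rewrite linearD !op_invK.
- by rewrite -innerZl; congr inner; apply: posop_inj; rewrite linearZ !op_invK.
- rewrite -{2}(op_invK x) innerC.
  exact: (form_ge0 (semi_inner_posop (ltW alpha_gt0) U_pos)).
Qed.

Lemma inv_form_op x y : inv_form U (U x) y = inner x y.
Proof. by rewrite /inv_form op_inv_linearK. Qed.

(** Cauchy-Schwarz for the form of [U], applied to [U^-1 x] and [x]. *)
Lemma inv_form_lower x : `|x| ^+ 2 <= op_norm U * inv_form U x x.
Proof.
have [->|x0] := eqVneq x 0.
  by rewrite (form0l semi_inner_inv_form) mulr0 normr0 expr0n.
have nx : 0 < `|x| ^+ 2 by rewrite exprn_gt0 ?normr_gt0.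
have := form_cauchy_schwarz (semi_inner_posop (ltW alpha_gt0) U_pos) (op_inv U x) x.
rewrite op_invK innerxx expr2 [inner x _]innerC -/(inv_form U x x) => h.
rewrite -(ler_pM2r nx); apply: le_trans h _.
rewrite [_ * inv_form _ _ _]mulrC -mulrA ler_wpM2l ?posop_le//.
exact: form_ge0 semi_inner_inv_form _.
Qed.

Lemma inv_form_upper x : inv_form U x x <= alpha^-1 * `|x| ^+ 2.
Proof.
rewrite ler_pdivlMl// /inv_form; set v := op_inv U x.
have vx : inner v x <= `|v| * `|x|.
  exact: le_trans (ler_norm _) (inner_le_norm _ _).
have := posop_ge v; rewrite op_invK innerC => av.
have [v0|v0] := eqVneq `|v| 0.
  by rewrite v0 mul0r in vx; rewrite (le_trans _ (sqr_ge0 _))// pmulr_rle0.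
have nv : 0 < `|v| by rewrite lt_neqAle eq_sym v0 /=.
have avx : alpha * `|v| <= `|x|.
  by rewrite -(ler_pM2r nv) -mulrA -expr2 [leRHS]mulrC; exact: le_trans av vx.
apply: (@le_trans _ _ (alpha * (`|v| * `|x|))); first by rewrite ler_pM2l.
by rewrite mulrA expr2 ler_wpM2r.
Qed.

End OnePositiveOperator.

(** Inversion reverses the order of operators.  With [u = U^-1 x] and [v = V^-1 x],
    the form of [U] takes the value [<x, v>] at [u] and [v]; apply Cauchy-Schwarz to it. *)
Lemma inv_form_antitone (alpha c : R) (U V : {linear H -> H}) x :
  0 < alpha -> 0 <= c -> posop alpha U -> posop alpha V ->
  loewner_le U (fun z => c *: V z) -> inv_form V x x <= c * inv_form U x x.
Proof.
move=> a0 c0 pU pV UV.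
have fU := semi_inner_posop (ltW a0) pU; have fV := semi_inner_posop (ltW a0) pV.
set u := op_inv U x; set v := op_inv V x.
have := form_cauchy_schwarz fU u v.
rewrite (op_invK a0 pU) [inner x v]innerC -/(inv_form V x x).
rewrite [inner x u]innerC -/(inv_form U x x).
have := UV v; rewrite innerZl (op_invK a0 pV) [inner x v]innerC -/(inv_form V x x).
have := form_ge0 (semi_inner_inv_form a0 pU) x.
have := form_ge0 (semi_inner_inv_form a0 pV) x.
move: (inv_form V x x) (inv_form U x x) (inner _ _) => p q s p0 q0 sp ps.
have [->|p1] := eqVneq p 0; first by rewrite mulr_ge0.
have pp : 0 < p by rewrite lt_neqAle eq_sym p1.
rewrite -(ler_pM2r pp) -expr2; apply: le_trans ps _.
by rewrite -mulrA mulrCA ler_wpM2l.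
Qed.

End PositiveOperators.

(** * Quasi-Fejer sequences of real numbers *)

Section RealSequences.
Context {R : realType}.
Implicit Types u eta eps gap : nat -> R.

Lemma nneseries_psum_bounded u : (forall k, 0 <= u k) ->
  (\sum_(0 <= k <oo) (u k)%:E < +oo)%E ->
  exists S, forall n, \sum_(0 <= k < n) u k <= S.
Proof.
move=> u0 us.
have s0 : (0 <= \sum_(0 <= k <oo) (u k)%:E)%E.
  by apply: nneseries_ge0 => k _ _; rewrite lee_fin.
exists (fine (\sum_(0 <= k <oo) (u k)%:E)%E) => n.
rewrite -lee_fin fineK ?ge0_fin_numE// -sumEFin.
by apply: nneseries_lim_ge => k _ _; rewrite lee_fin.
Qed.

Lemma bounded_psum_cvg u S : (forall k, 0 <= u k) ->
  (forall n, \sum_(0 <= k < n) u k <= S) ->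
  cvgn (fun n => \sum_(0 <= k < n) u k).
Proof.
move=> u0 uS; apply: nondecreasing_is_cvgn; last by exists S => _ [n _ <-].
by apply/nondecreasing_seqP => n; rewrite big_nat_recr//= lerDl.
Qed.

Lemma bounded_psum_cvg0 u S : (forall k, 0 <= u k) ->
  (forall n, \sum_(0 <= k < n) u k <= S) -> u @ \oo --> (0 : R).
Proof.
move=> u0 uS; apply: cvg_series_cvg_0.
exact: bounded_psum_cvg u0 uS.
Qed.

Definition growth eta n : R := \prod_(0 <= j < n) (1 + eta j).

Lemma growthS eta n : growth eta n.+1 = growth eta n * (1 + eta n).
Proof. by rewrite /growth big_nat_recr. Qed.

Lemma growth_ge1 eta n : (forall k, 0 <= eta k) -> 1 <= growth eta n.
Proof.
move=> eta0; elim: n => [|n IH]; first by rewrite /growth big_geq.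
by rewrite growthS; apply: mulr_ege1 => //; rewrite lerDl.
Qed.

Lemma growth_cvg eta S : (forall k, 0 <= eta k) ->
  (forall n, \sum_(0 <= k < n) eta k <= S) -> cvgn (growth eta).
Proof.
move=> eta0 etaS; apply: nondecreasing_is_cvgn.
  apply/nondecreasing_seqP => n; rewrite growthS ler_peMr ?lerDl//.
  exact: le_trans ler01 (growth_ge1 _ eta0).
exists (expR S) => _ [n _ <-].
suff h : growth eta n <= expR (\sum_(0 <= k < n) eta k).
  by apply: le_trans h _; rewrite ler_expR.
elim: n => [|n IH]; first by rewrite /growth !big_geq// expR0.
rewrite growthS big_nat_recr//= expRD ler_pM ?expR_ge1Dx ?addr_ge0//.
exact: le_trans ler01 (growth_ge1 _ eta0).
Qed.

(** Dividing [u n] by the convergent product of the factors [1 + eta] and subtracting the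
    partial sums of [eps] yields a nonincreasing sequence. *)
Lemma quasi_fejer_cvg u eta eps S T :
  (forall k, 0 <= u k) -> (forall k, 0 <= eta k) -> (forall k, 0 <= eps k) ->
  (forall n, \sum_(0 <= k < n) eta k <= S) ->
  (forall n, \sum_(0 <= k < n) eps k <= T) ->
  (forall k, u k.+1 <= (1 + eta k) * (u k + eps k)) -> cvgn u.
Proof.
move=> u0 eta0 eps0 etaS epsT urec.
pose c := growth eta; pose s n := \sum_(0 <= k < n) eps k.
have c1 n : 1 <= c n by exact: growth_ge1.
have c0 n : 0 < c n by exact: lt_le_trans ltr01 (c1 n).
pose v n := u n / c n - s n.
have vcvg : cvgn v.
  apply: nonincreasing_is_cvgn.
    apply/nonincreasing_seqP => n.
    rewrite /v {1}/s big_nat_recr//= -/(s n) opprD addrA addrAC lerD2r.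
    rewrite lerBlDr ler_pdivrMr// /c growthS -/(c n) mulrDl mulrA divfK ?gt_eqF//.
    apply: le_trans (urec n) _; rewrite mulrC -subr_ge0.
    have -> : u n * (1 + eta n) + eps n * (c n * (1 + eta n))
      - (u n + eps n) * (1 + eta n) = eps n * (1 + eta n) * (c n - 1) by ring.
    apply: mulr_ge0; last by rewrite subr_ge0.
    by apply: mulr_ge0 => //; rewrite addr_ge0.
  exists (- T) => _ [n _ <-]; have : 0 <= u n / c n by rewrite divr_ge0// ltW.
  by have := epsT n; rewrite -/(s n) /v; lra.
have -> : u = (fun n => c n * (v n + s n)).
  by apply/funext => n; rewrite /v subrK mulrC divfK ?gt_eqF.
apply: is_cvgM; first exact: growth_cvg eta0 etaS.
exact: (is_cvgD vcvg (bounded_psum_cvg eps0 epsT)).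
Qed.

Lemma squeeze0_cvg u v : (forall k, 0 <= u k <= v k) ->
  v @ \oo --> (0 : R) -> u @ \oo --> (0 : R).
Proof.
move=> uv v0; apply: (squeeze_cvgr _ (cvg_cst 0) v0); exact: nearW.
Qed.

Lemma cvg0_sqrt u : u @ \oo --> (0 : R) -> Num.sqrt (u k) @[k --> \oo] --> (0 : R).
Proof.
move=> u0; rewrite -(@sqrtr0 R).
by apply: (cvg_comp u Num.sqrt u0); exact: sqrt_continuous.
Qed.

Lemma cvg0_cstM (c : R) u : u @ \oo --> (0 : R) -> c * u k @[k --> \oo] --> (0 : R).
Proof. by move=> u0; rewrite -(mulr0 c); apply: cvgM => //; exact: cvg_cst. Qed.

Lemma cvg0D u v : u @ \oo --> (0 : R) -> v @ \oo --> (0 : R) ->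
  u k + v k @[k --> \oo] --> (0 : R).
Proof. by move=> u0 v0; rewrite -(addr0 0); exact: cvgD. Qed.

(** Once [u] converges, the recurrence bounds [gap k] by a difference of two sequences with the
    same limit. *)
Lemma quasi_fejer_gap u eta eps gap S T :
  (forall k, 0 <= u k) -> (forall k, 0 <= eta k) -> (forall k, 0 <= eps k) ->
  (forall k, 0 <= gap k) ->
  (forall n, \sum_(0 <= k < n) eta k <= S) ->
  (forall n, \sum_(0 <= k < n) eps k <= T) ->
  (forall k, u k.+1 ^+ 2 <= (1 + eta k) * ((u k + eps k) ^+ 2 - gap k)) ->
  cvgn u /\ gap @ \oo --> (0 : R).
Proof.
move=> u0 eta0 eps0 gap0 etaS epsT urec.
have ucvg : cvgn u.
  apply: (quasi_fejer_cvg u0 eta0 eps0 etaS epsT) => k.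
  have e1 : 0 <= 1 + eta k by rewrite addr_ge0.
  have s0 : 0 <= u k + eps k by rewrite addr_ge0.
  rewrite -(@ler_pXn2r _ 2) ?nnegrE ?mulr_ge0//; apply: le_trans (urec k) _.
  rewrite exprMn [X in _ <= X * _]expr2 -mulrA ler_wpM2l//.
  apply: (@le_trans _ _ ((u k + eps k) ^+ 2)); first by rewrite gerBl.
  by rewrite ler_peMl ?sqr_ge0// lerDl.
split=> //; have /cvg_ex[l ul] := ucvg.
have uSl : u k.+1 @[k --> \oo] --> l by have := ul; rewrite -(cvg_shiftS u).
have eta_0 := bounded_psum_cvg0 eta0 etaS.
have eps_0 := bounded_psum_cvg0 eps0 epsT.
have lim : (1 + eta k) * ((u k + eps k) * (u k + eps k)) - u k.+1 * u k.+1
    @[k --> \oo] --> (1 + 0) * ((l + 0) * (l + 0)) - l * l.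
  apply: cvgB; last exact: cvgM.
  apply: cvgM; first by apply: cvgD => //; exact: cvg_cst.
  by apply: cvgM; exact: cvgD.
rewrite !addr0 mul1r subrr in lim.
apply: squeeze0_cvg lim => k; rewrite gap0 /= -!expr2.
have := urec k; have : 0 <= eta k * gap k by rewrite mulr_ge0.
by rewrite mulrBr mulrDl; lra.
Qed.

End RealSequences.

(** * Convergence along ultrafilters *)

Section Ultrafilters.

Lemma ultra_cvg (T : Type) (Y : topologicalType) (F : set_system T) (f : T -> Y) (l : Y) :
  ProperFilter F ->
  (forall G, UltraFilter G -> F `<=` G -> f @ G --> l) -> f @ F --> l.
Proof.
move=> FF fl A lA; apply: contrapT => nFA.
pose D := ~` (f @^-1` A).
have PW : ProperFilter (within D F).
  split; last exact: within_filter.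
  by rewrite /within /= => FD; apply: nFA; apply: filterS FD => t; exact: contrapT.
have [G [GU WG]] := ultraFilterLemma PW.
have FG : F `<=` G by move=> P FP; apply: WG; apply: filterS FP.
have GD : G D by apply: WG; exact: withinT.
have GA : G (f @^-1` A) by exact: fl lA.
by have /filter_ex[t []] : G (f @^-1` A `&` D) by exact: filterI.
Qed.

Lemma ultra_fmap (T Y : Type) (f : T -> Y) (F : set_system T) :
  UltraFilter F -> UltraFilter (f @ F).
Proof.
move=> FU; split=> [|G GF fFG]; first exact: fmap_proper_filter.
rewrite eqEsubset; split=> // A GA.
have [//|FnA] := in_ultra_setVsetC (f @^-1` A) FU.
have GnA : G (~` A) by exact: fFG.
by have /filter_ex[t []] : G (A `&` ~` A) by exact: filterI.
Qed.

Lemma bounded_ultra_cvg (R : realType) (T : Type) (F : set_system T) (f : T -> R) (M : R) :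
  UltraFilter F -> (forall t, `|f t| <= M) -> cvg (f @ F).
Proof.
move=> FU fM; have fFU := ultra_fmap f FU.
have := @segment_compact R (- M) M; rewrite compact_ultra => /(_ _ fFU) [].
  suff : F (f @^-1` `[- M, M]) by [].
  by apply: filterE => t; rewrite /= in_itv /= -ler_norml.
by move=> l [_ fl]; apply/cvg_ex; exists l.
Qed.

End Ultrafilters.

(** * Weak convergence *)

Section WeakTopology.
Context {R : realType} {H : hilbertType R}.
Let iH := semi_inner_inner H.

(** The limits of the scalars [inner (x t) v] exist by compactness of segments; they depend
    linearly and boundedly on [v], so the Riesz theorem represents them. *)
Lemma bounded_ultra_weak_cvg (T : Type) (F : set_system T) (x : T -> H) (M : R) :
  UltraFilter F -> (forall t, `|x t| <= M) ->
  exists p, forall v, inner (x t) v @[t --> F] --> inner p v.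
Proof.
move=> FU xM.
have bnd v t : `|inner (x t) v| <= M * `|v|.
  by apply: le_trans (inner_le_norm _ _) _; rewrite ler_wpM2r.
have cv v : cvg (inner (x t) v @[t --> F]) by exact: bounded_ultra_cvg (bnd v).
pose phi v := lim (inner (x t) v @[t --> F]).
have [|||p pP] := @riesz R H phi M.
- move=> u v; rewrite /phi -limD//; congr (lim _).
  by congr (_ @ F); apply/funext => t /=; rewrite (formDr iH).
- move=> a v; apply/cvg_lim => //.
  under eq_fun do rewrite (formZr iH).
  by apply: cvgM; [exact: cvg_cst|exact: cv].
- move=> v; rewrite ler_norml; apply/andP; split.
    by apply: limr_ge => //; apply: nearW => t;
      have := bnd v t; rewrite ler_norml => /andP[].
  by apply: limr_le => //; apply: nearW => t; have := bnd v t; rewrite ler_norml => /andP[].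
by exists p => v; rewrite pP; exact: cv.
Qed.

(** Closed convex sets are weakly closed: the half-space that separates [p] from its projection
    onto [C] is weakly closed and contains the sequence. *)
Lemma weak_limit_closed_convex (F : set_system nat) (x : nat -> H) p (C : set H) :
  ProperFilter F -> closed C -> convex_set C -> (forall k, C (x k)) ->
  (forall v, inner (x k) v @[k --> F] --> inner p v) -> C p.
Proof.
move=> FF Ccl Ccv Cx xp.
have /filter_ex[t0 _] : F setT by exact: filterT.
have C0 : C !=set0 by exists (x t0).
have [] := norm_proj_variational p C0 Ccl Ccv; set q := metric_proj _ _ _ => Cq qP.
suff -> : p = q by [].
apply/eqP; rewrite -subr_eq0 -normr_eq0 -sqrf_eq0 -innerxx eq_le (form_ge0 iH) andbT.
rewrite {1}(formDl iH) (formNl iH) subr_le0.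
apply: (ler_cvg_to (xp (p - q)) (cvg_cst _)); apply: nearW => t.
by have := qP _ (Cx t); rewrite (formDr iH) (formNr iH) subr_ge0 ![inner (p - q) _]innerC.
Qed.

Lemma inner_cvg_diff (T : Type) (F : set_system T) {FF : Filter F} (a : T -> H) l (x : T -> H) M :
  a @ F --> l -> (forall t, `|x t| <= M) ->
  inner (a t - l) (x t) @[t --> F] --> (0 : R).
Proof.
move=> al xM; apply: norm_cvg0.
have lim0 : `|a t - l| * M @[t --> F] --> (0 : R).
  rewrite -(mul0r M); apply: cvgM; last exact: cvg_cst.
  rewrite -(@normr0 _ H) -(subrr l); apply: cvg_norm; apply: cvgB => //.
  exact: cvg_cst.
apply: (squeeze_cvgr _ (cvg_cst 0) lim0); apply: nearW => t; rewrite normr_ge0 /=.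
by apply: le_trans (inner_le_norm _ _) _; rewrite ler_wpM2l.
Qed.

Lemma inner_cvgl (T : Type) (F : set_system T) {FF : Filter F} (a : T -> H) l z :
  a @ F --> l -> inner (a t) z @[t --> F] --> inner l z.
Proof.
move=> al; rewrite -[X in _ --> X]add0r.
have -> : (fun t => inner (a t) z) = (fun t => inner (a t - l) z + inner l z).
  by apply/funext => t; rewrite (formDl iH) (formNl iH) subrK.
apply: cvgD; last exact: cvg_cst.
exact: (inner_cvg_diff al (fun=> lexx `|z|)).
Qed.

(** Divided by [growth eta], the forms decrease, hence converge on the diagonal.  For a
    nonnegative form [D] bounded by [K], represented by an operator [A], Cauchy-Schwarz gives
    [|A x|^2 <= K D x x]; applied to the differences of these forms, it turns the convergence
    on the diagonal into strong convergence of the operators. *)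
Lemma antitone_form_cvg (A : nat -> H -> H) (eta : nat -> R) (S K : R) :
  (forall k, 0 <= eta k) -> (forall n, \sum_(0 <= k < n) eta k <= S) ->
  (forall k, semi_inner (fun x y => inner (A k x) y)) ->
  (forall k x, inner (A k x) x <= K * `|x| ^+ 2) ->
  (forall k x, inner (A k.+1 x) x <= (1 + eta k) * inner (A k x) x) ->
  forall x, cvgn (A ^~ x).
Proof.
move=> eta0 etaS fA AK Amono x.
pose c := growth eta.
have c1 n : 1 <= c n by exact: growth_ge1.
have c0 n : 0 < c n by exact: lt_le_trans ltr01 (c1 n).
pose f n z := inner (A n z) z / c n.
have f_mono z i j : (i <= j)%N -> f j z <= f i z.
  move: i j; apply/nonincreasing_seqP => n.
  rewrite /f ler_pdivrMr// /c growthS mulrA divfK ?gt_eqF// mulrC; exact: Amono.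
have f_ge0 n z : 0 <= f n z by rewrite divr_ge0 ?(form_ge0 (fA n))// ltW.
have f_le n z : f n z <= K * `|z| ^+ 2.
  apply: le_trans (AK n z); rewrite ler_pdivrMr// ler_peMr//.
  exact: (form_ge0 (fA n)).
have f_cvg : cvgn (f ^~ x).
  apply: nonincreasing_is_cvgn; first by move=> i j; exact: f_mono.
  by exists 0 => _ [n _ <-].
pose l := lim (f n x @[n --> \oo]).
have step i j : (i <= j)%N ->
    `|(c i)^-1 *: A i x - (c j)^-1 *: A j x| ^+ 2 <= `|K| * (f i x - f j x).
  move=> ij; set v := _ - _.
  pose D y z := inner ((c i)^-1 *: A i y - (c j)^-1 *: A j y) z.
  have DE y z : D y z = (c i)^-1 * inner (A i y) z - (c j)^-1 * inner (A j y) z.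
    by rewrite /D (formDl iH) (formNl iH) !(formZl iH).
  have fD : semi_inner D.
    split=> [y z|y z w|a y z|y]; rewrite !DE.
    - by rewrite (formC (fA i)) (formC (fA j)).
    - by rewrite (formDl (fA i)) (formDl (fA j)); ring.
    - by rewrite (formZl (fA i)) (formZl (fA j)); ring.
    - by rewrite subr_ge0 ![_^-1 * _]mulrC; exact: f_mono.
  have Dxx y : D y y = f i y - f j y by rewrite DE /f ![_^-1 * _]mulrC.
  have := form_cauchy_schwarz fD x v; rewrite {1}/D -/v innerxx.
  have : D v v <= `|K| * `|v| ^+ 2.
    rewrite Dxx; apply: (@le_trans _ _ (K * `|v| ^+ 2)).
      by have := f_ge0 j v; have := f_le i v; lra.
    by rewrite ler_wpM2r ?sqr_ge0// ler_norm.
  have := form_ge0 fD x; rewrite -Dxx.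
  have := sqr_ge0 `|v|; move: (D x x) (D v v) (`|v| ^+ 2) => p q s s0 p0 qs sp.
  have [->|s1] := eqVneq s 0; first by rewrite mulr_ge0.
  have sp0 : 0 < s by rewrite lt_neqAle eq_sym s1.
  rewrite -(ler_pM2r sp0) -expr2; apply: le_trans sp _.
  by rewrite mulrAC [leRHS]mulrC ler_wpM2l.
have gcvg : cvgn (fun n => (c n)^-1 *: A n x).
  apply: (@sqr_cauchy_is_cvgn _ _ _ (fun n => `|K| * `|f n x - l|)).
    rewrite -(mulr0 `|K|); apply: cvgM; first exact: cvg_cst.
    rewrite -(@normr0 _ R) -(subrr l); apply: cvg_norm; apply: cvgB => //.
    exact: cvg_cst.
  move=> i j /=; rewrite -mulrDr.
  wlog ij : i j / (i <= j)%N.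
    move=> h; have [/h//|/ltnW/h] := leqP i j.
    by rewrite distrC [_ + `|f i x - l|]addrC.
  apply: le_trans (step _ _ ij) _; rewrite ler_wpM2l//.
  apply: le_trans (ler_norm _) _.
  rewrite [X in _ <= _ + X]distrC; exact: ler_distD.
have -> : A ^~ x = (fun n => c n *: ((c n)^-1 *: A n x)).
  by apply/funext => n; rewrite scalerA divff ?scale1r// gt_eqF.
by apply: is_cvgZ => //; exact: growth_cvg eta0 etaS.
Qed.

(** If [p] and [q] are two weak limits in [W], the difference of their squared distances to
    [x k] converges, hence so does [inner (A k (p - q)) (x k)].  As [A k (p - q)] converges
    strongly to some [a], both [inner a p] and [inner a q] are the limit of this sequence, so
    [inner a (p - q) = 0], and the uniform lower bound on the metrics gives [p = q]. *)
Lemma variable_metric_opial (A : nat -> H -> H) (x : nat -> H) (W : set H) (mu M : R) :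
  (forall k, semi_inner (fun u v => inner (A k u) v)) ->
  (forall k u, `|u| ^+ 2 <= mu * inner (A k u) u) ->
  (forall u, cvgn (A ^~ u)) ->
  (forall k, `|x k| <= M) ->
  (forall z, W z -> cvgn (fun k => inner (A k (x k - z)) (x k - z))) ->
  (forall F p, UltraFilter F -> \oo `<=` F ->
    (forall v, inner (x k) v @[k --> F] --> inner p v) -> W p) ->
  exists2 p, W p & weak_cvg x p.
Proof.
move=> fA A_ge A_cvg xM W_cvg W_ultra.
have [F0 [F0U F0oo]] := ultraFilterLemma eventually_filter.
have [p xp] := bounded_ultra_weak_cvg F0U xM.
have Wp : W p by exact: W_ultra xp.
exists p => // v; apply: ultra_cvg => F FU Foo.
have [q xq] := bounded_ultra_weak_cvg FU xM.
suff -> : p = q by exact: xq.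
have Wq : W q by exact: W_ultra xq.
pose w := p - q; have /cvg_ex[a Aw] := A_cvg w.
have Bcvg z : cvgn (fun k => inner (A k z) z).
  have /cvg_ex[b Ab] := A_cvg z.
  by apply/cvg_ex; exists (inner b z); exact: inner_cvgl.
have hcvg : cvgn (fun k => inner (A k w) (x k)).
  have -> : (fun k => inner (A k w) (x k)) = (fun k => 2^-1 *
      (inner (A k (x k - q)) (x k - q) - inner (A k (x k - p)) (x k - p)
      + (inner (A k p) p - inner (A k q) q))).
    apply/funext => k; have fB := fA k; rewrite /w.
    rewrite (formC fB (p - q)) !(formE fB) (formC fB p (x k)) (formC fB q (x k)).
    by field.
  apply: is_cvgM; first exact: is_cvg_cst.
  apply: is_cvgD; apply: is_cvgB; [exact: W_cvg|exact: W_cvg|exact: Bcvg|exact: Bcvg].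
have /cvg_ex[l Al] := hcvg.
have aw G z : UltraFilter G -> \oo `<=` G ->
    (forall v, inner (x k) v @[k --> G] --> inner z v) -> inner z a = l.
  move=> GU Goo xz.
  have AlG : inner (A k w) (x k) @[k --> G] --> l by move=> P /Al; exact: Goo.
  have AwG : A k w @[k --> G] --> a by move=> P /Aw; exact: Goo.
  suff xl : inner (x k) a @[k --> G] --> l.
    by apply: (cvg_unique _ (xz a) xl).
  have -> : (fun k => inner (x k) a) =
      (fun k => inner (A k w) (x k) - inner (A k w - a) (x k)).
    by apply/funext => k; rewrite (formDl iH) (formNl iH) opprB addrC subrK innerC.
  by rewrite -[X in _ --> X]subr0; apply: cvgB => //; exact: inner_cvg_diff AwG xM.
have wa : inner w a = 0 by rewrite (formDl iH) (formNl iH) (aw F0)// (aw F) ?subrr.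
apply/eqP; rewrite -subr_eq0 -/w -normr_eq0 -sqrf_eq0 eq_le sqr_ge0 andbT.
have lim0 : mu * inner (A k w) w @[k --> \oo] --> (0 : R).
  rewrite -(mulr0 mu); apply: cvgM; first exact: cvg_cst.
  by rewrite -wa [inner w a]innerC; exact: inner_cvgl.
by apply: (ler_cvg_to (cvg_cst (`|w| ^+ 2)) lim0); apply: nearW.
Qed.
End WeakTopology.

(** * One step of the iteration *)

Section InverseMetricProjection.
Context {R : realType} {H : hilbertType R} (alpha : R) (U : {linear H -> H}) (C : set H).
Hypotheses (alpha_gt0 : 0 < alpha) (U_pos : posop alpha U) (U_gt0 : 0 < op_norm U)
  (C_neq0 : C !=set0) (C_closed : closed C) (C_convex : convex_set C).

Let fB := semi_inner_inv_form alpha_gt0 U_pos.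

Let inv_form_ge v : (op_norm U)^-1 * `|v| ^+ 2 <= inv_form U v v.
Proof. by rewrite ler_pdivrMl//; exact: inv_form_lower alpha_gt0 U_pos v. Qed.

Lemma norm_inv_proj_variational x : let p := metric_proj (norm_inv U) C x in
  C p /\ forall c, C c -> 0 <= inv_form U (x - p) (p - c).
Proof.
by apply: (metric_proj_variational fB _ inv_form_ge (inv_form_upper alpha_gt0 U_pos));
  rewrite ?invr_gt0.
Qed.

Lemma norm_inv_proj_nonexpansive x y :
  norm_inv U (metric_proj (norm_inv U) C x - metric_proj (norm_inv U) C y)
  <= norm_inv U (x - y).
Proof.
by apply: (metric_proj_nonexpansive fB _ inv_form_ge (inv_form_upper alpha_gt0 U_pos));
  rewrite ?invr_gt0.
Qed.

End InverseMetricProjection.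

Section RelaxedStep.
Context {R : realType} {V : lmodType R} {B : V -> V -> R}.
Hypothesis fB : semi_inner B.

(** The difference of the two sides is [lam * (2 - kap / 2 - lam) * B (D + E) (D + E)]. *)
Lemma relaxed_step_gap (D E X : V) (kap lam : R) :
  0 < kap -> 0 <= lam <= 2 - kap / 2 ->
  let W := (2 - kap) *: D - kap *: E in
  B (X - lam *: (D + E)) (X - lam *: (D + E))
    + 2 * lam * ((B D X - B D D / kap) + B E (X - D - E) + B W W / (4 * kap))
  <= B X X.
Proof.
move=> kap0 /andP[lam0 lam_le] /=; set W := _ - kap *: E; rewrite -subr_ge0.
have -> : B X X - (B (X - lam *: (D + E)) (X - lam *: (D + E))
    + 2 * lam * ((B D X - B D D / kap) + B E (X - D - E) + B W W / (4 * kap)))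
    = lam * (2 - kap / 2 - lam) * B (D + E) (D + E).
  rewrite /W !(formE fB) (formC fB X D) (formC fB X E) (formC fB E D).
  by field; rewrite gt_eqF.
apply: mulr_ge0; last exact: form_ge0.
by apply: mulr_ge0; rewrite // subr_ge0.
Qed.

(** Combined with a small [gap], this bounds [B D D]: the left side is about [B D D / kap], and
    the right side is of the order of the norm of [W]. *)
Lemma step_alignment (D E X : V) (kap : R) : 0 < kap < 2 ->
  let W := (2 - kap) *: D - kap *: E in
  2 * B D D / kap - B D X + kap / (2 - kap) * B E (X - D - E)
  = B W (kap^-1 *: D - (2 - kap)^-1 *: (X - D - E)).
Proof.
case/andP=> kap0 kap2 W.
have kap2' : 2 - kap != 0 by rewrite subr_eq0 gt_eqF.
rewrite /W !(formE fB) (formC fB E D).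
by field; rewrite kap2' gt_eqF.
Qed.

End RelaxedStep.

Section SfpStep.
Context {R : realType} {H G : hilbertType R}.
Variables (L : {linear H -> G}) (C : set H) (Q : set G) (beta : R).
Hypotheses (L_bounded : bounded_fun_norm L) (L_gt0 : 0 < op_norm L)
  (betaE : beta = 1 / op_norm L ^+ 2)
  (C_closed : closed C) (C_convex : convex_set C)
  (Q_closed : closed Q) (Q_convex : convex_set Q).

Definition sfp_residual (x : H) : R := `|L x - metric_proj Num.norm Q (L x)| ^+ 2.

Definition sfp_step (U : H -> H) (gam : R) (x : H) : H :=
  metric_proj (norm_inv U) C (x - gam *: U (sfp_grad L Q x)).

Lemma sfp_grad_le x : beta * `|sfp_grad L Q x| ^+ 2 <= sfp_residual x.
Proof.
rewrite betaE div1r ler_pdivrMl ?exprn_gt0// /sfp_residual -exprMn.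
by apply: ler_pM => //; exact: adjoint_norm_le.
Qed.

Lemma sfp_grad_solution xs : sfp L C Q xs -> sfp_grad L Q xs = 0.
Proof.
move=> [_ Qxs]; rewrite /sfp_grad.
have [_ /(_ _ Qxs)] := norm_proj_variational (L xs) (ex_intro _ _ Qxs) Q_closed Q_convex.
set p := metric_proj _ _ _; have iG := semi_inner_inner G.
rewrite -(opprB (L xs) p) (formNr iG) innerxx oppr_ge0 => p0.
suff -> : L xs - p = 0 by exact: adjoint0.
by apply/eqP; rewrite -normr_eq0 -sqrf_eq0 eq_le p0 sqr_ge0.
Qed.

(** The difference of the two sides is the inner product expressing the obtuse angle at the
    projection of [L x] onto [Q]. *)
Lemma sfp_grad_inner x xs : sfp L C Q xs ->
  sfp_residual x <= inner (sfp_grad L Q x) (x - xs).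
Proof.
move=> [_ Qxs]; rewrite innerC /sfp_grad -adjointP// linearB.
have [_ /(_ _ Qxs)] := norm_proj_variational (L x) (ex_intro _ _ Qxs) Q_closed Q_convex.
have iG := semi_inner_inner G.
rewrite /sfp_residual -innerxx; set p := metric_proj _ _ _ => h.
rewrite [inner (L x - L xs) _]innerC.
have -> : L x - L xs = (L x - p) + (p - L xs) by rewrite addrA subrK.
by rewrite [leRHS](formDr iG) lerDl.
Qed.

Section OneStep.
Variables (alpha gam kap : R) (U : {linear H -> H}) (x xs : H).
Hypotheses (alpha_gt0 : 0 < alpha) (U_pos : posop alpha U) (gam_gt0 : 0 < gam)
  (kapE : kap = gam * op_norm U / beta) (kap_itv : 0 < kap < 2)
  (xs_sol : sfp L C Q xs).

Let N := form_norm (inv_form U).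
Let T := sfp_step U gam x.

(** The [gap] is the guaranteed decrease of the squared distance to [xs], per unit of [2 lam].
    The second estimate says that a small [gap] forces a small residual, even when [lam] is close
    to its upper bound and the first estimate gives no control of the displacement. *)
Lemma sfp_step_estimates : exists2 gap, 0 <= gap &
  [/\ forall lam, 0 <= lam <= 2 - kap / 2 ->
        N (x + lam *: (T - x) - xs) ^+ 2 + 2 * lam * gap <= N (x - xs) ^+ 2,
      gam * sfp_residual x <=
        2 * gap + Num.sqrt (4 * kap * gap) * ((2 / kap + 3 / (2 - kap)) * N (x - xs)) &
      kap * N (x - T) <=
        2 * Num.sqrt (kap * (gam * sfp_residual x)) + Num.sqrt (4 * kap * gap)].
Proof.
have fB := semi_inner_inv_form alpha_gt0 U_pos.
have /andP[kap0 kap2] := kap_itv.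
have b0 : 0 < beta by rewrite betaE div1r invr_gt0 exprn_gt0.
have U0 : 0 < op_norm U.
  by have := kap0; rewrite kapE pmulr_lgt0 ?invr_gt0// pmulr_rgt0.
have [Cxs _] := xs_sol.
have C0 : C !=set0 by exists xs.
pose g := sfp_grad L Q x; pose D := gam *: U g; pose E := x - D - T; pose X := x - xs.
have PE : X - D - E = T - xs.
  by rewrite /X /E [x - xs - D]addrAC opprB [LHS]addrC addrA subrK.
have DE : D + E = x - T by rewrite /E addrC addrAC subrK.
have [_ /(_ _ Cxs)] := norm_inv_proj_variational alpha_gt0 U_pos U0 C0 C_closed C_convex (x - D).
rewrite -/(sfp_step U gam x) -/T -/E => q0.
have BD v : inv_form U D v = gam * inner g v.
  by rewrite (formZl fB) (inv_form_op alpha_gt0 U_pos).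
have BDX : gam * sfp_residual x <= inv_form U D X.
  by rewrite BD ler_pM2l// sfp_grad_inner.
have BDD : inv_form U D D <= kap * (gam * sfp_residual x).
  rewrite BD (formZr (semi_inner_inner H)) [inner g _]innerC.
  have h1 := posop_le U_pos g; have h2 := sfp_grad_le x.
  rewrite [kap * _]mulrCA ler_pM2l// kapE mulrAC -2!mulrA ler_pM2l//.
  apply: le_trans h1 _; by rewrite ler_pM2l// ler_pdivlMr// mulrC.
(* [B D D <= kap * B D X], so Cauchy-Schwarz bounds [D] by [X] *)
have NDX : N D <= 2 * N X.
  have := form_le_norm fB D X; have := form_norm_ge0 (B := inv_form U) X.
  have := form_norm_ge0 (B := inv_form U) D.
  rewrite -/(N D) -/(N X) => ND0 NX0 /(le_trans (ler_norm _)) h.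
  have [->|ND] := eqVneq (N D) 0; first by rewrite mulr_ge0.
  have NDgt : 0 < N D by rewrite lt_neqAle eq_sym ND.
  rewrite -(ler_pM2l NDgt) -expr2 /N sqr_form_norm// -/(N D) -/(N X).
  apply: le_trans BDD _; apply: (@le_trans _ _ (2 * inv_form U D X)).
    apply: ler_pM => //; [exact: ltW| |exact: ltW].
    by rewrite mulr_ge0 ?sqr_ge0// ltW.
  by rewrite mulrCA ler_pM2l.
(* the projection fixes [xs], so it brings [x - D] no farther from [xs] *)
have NP : N (X - D - E) <= 3 * N X.
  have : N (X - D - E) <= N (x - D - xs).
    rewrite PE /N form_norm_le//.
    by have := form_obtuse_le fB q0; have := form_ge0 fB E; rewrite /E; lra.
  have := form_normD fB X (- D); rewrite form_normN// -/(N _) -/(N X) -/(N D).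
  by rewrite {1}/X addrAC; lra.
pose W := (2 - kap) *: D - kap *: E.
pose gap := (inv_form U D X - inv_form U D D / kap) + inv_form U E (X - D - E)
  + inv_form U W W / (4 * kap).
have W0 : 0 <= inv_form U W W / (4 * kap) by rewrite divr_ge0 ?(form_ge0 fB)// mulr_ge0 ?ltW.
have t0 : inv_form U D D / kap <= gam * sfp_residual x by rewrite ler_pdivrMr// mulrC.
have {}q0 : 0 <= inv_form U E (X - D - E) by rewrite PE.
have gap0 : 0 <= gap by rewrite /gap; lra.
have NW : N W <= Num.sqrt (4 * kap * gap).
  rewrite ler_wsqrtr// mulrC -ler_pdivrMr ?mulr_gt0//.
  by rewrite /gap; lra.
exists gap => //; split.
- move=> lam lamP; have := relaxed_step_gap fB D E X kap0 lamP.
  rewrite /N !sqr_form_norm//= -/W -/gap DE.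
  suff -> : X - lam *: (x - T) = x + lam *: (T - x) - xs by [].
  by rewrite -scalerN opprB /X addrAC.
- have := step_alignment fB D E X kap_itv; rewrite /= -/W.
  set V := _ - _ *: (X - D - E) => VE.
  have VW := le_trans (ler_norm _) (form_le_norm fB W V).
  have NV : N V <= (2 / kap + 3 / (2 - kap)) * N X.
    apply: le_trans (form_normD fB _ _) _; rewrite form_normN//.
    rewrite (form_normZ fB _ D) (form_normZ fB _ (X - D - E)).
    rewrite !ger0_norm ?invr_ge0 ?subr_ge0 ?(ltW kap0) ?(ltW kap2)//.
    have -> : (2 / kap + 3 / (2 - kap)) * N X
        = kap^-1 * (2 * N X) + (2 - kap)^-1 * (3 * N X) by ring.
    by apply: lerD; rewrite ler_pM2l ?invr_gt0 ?subr_gt0.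
  have c0 : 0 <= kap / (2 - kap) * inv_form U E (X - D - E).
    by rewrite mulr_ge0// divr_ge0 ?subr_ge0 ?ltW.
  have WV : N W * N V <= Num.sqrt (4 * kap * gap) * ((2 / kap + 3 / (2 - kap)) * N X).
    by rewrite ler_pM ?form_norm_ge0.
  have gapE : gap = (inv_form U D X - inv_form U D D / kap) + inv_form U E (X - D - E)
    + inv_form U W W / (4 * kap) by [].
  move: VE VW WV gapE; rewrite -/(N W) -/(N V) -/X => VE VW WV gapE.
  apply: (@le_trans _ _ (2 * gap + N W * N V)); last by rewrite lerD2l.
  by lra.
- have -> : kap * N (x - T) = N (2 *: D - W).
    rewrite -DE /N -[in LHS](ger0_norm (ltW kap0)) -form_normZ//; congr form_norm.
    by rewrite /W scalerBl scalerDr opprB [RHS]addrC -[RHS]addrA opprB subrK addrC.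
  apply: le_trans (form_normD fB _ _) _; rewrite form_normN//.
  rewrite (form_normZ fB _ D) ger0_norm//.
  by apply: lerD => //; rewrite ler_pM2l// ler_wsqrtr.
Qed.
End OneStep.
End SfpStep.

(** * Convergence of the perturbed iteration *)

Section Convergence.
Context {R : realType} {H G : hilbertType R}.
Variables (L : {linear H -> G}) (C : set H) (Q : set G).
Variables (beta alpha mu gamma0 gamma1 kap0 kap1 lambda0 : R).
Variables (eta gamma lambda kap : nat -> R) (U : nat -> {linear H -> H}).
Variables (a b x y : nat -> H) (S Sa Sb : R).
Hypotheses (L_bounded : bounded_fun_norm L) (L_gt0 : 0 < op_norm L)
  (C_closed : closed C) (C_convex : convex_set C)
  (Q_closed : closed Q) (Q_convex : convex_set Q)
  (betaE : beta = 1 / op_norm L ^+ 2) (sfp_neq0 : sfp L C Q !=set0)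
  (alpha_gt0 : 0 < alpha) (eta_ge0 : forall k, 0 <= eta k)
  (eta_sum : forall n, \sum_(0 <= k < n) eta k <= S)
  (U_pos : forall k, posop alpha (U k))
  (U_le : forall k, op_norm (U k) <= mu)
  (U_mono : forall k, loewner_le (U k) (fun z => (1 + eta k) *: U k.+1 z))
  (gamma0_gt0 : 0 < gamma0) (gamma_itv : forall k, gamma0 <= gamma k <= gamma1)
  (kapE : forall k, kap k = gamma k * op_norm (U k) / beta)
  (kap0_gt0 : 0 < kap0) (kap1_lt2 : kap1 < 2)
  (kap_itv : forall k, kap0 <= kap k <= kap1)
  (lambda0_gt0 : 0 < lambda0)
  (lambda_itv : forall k, lambda0 <= lambda k <= 2 - kap k / 2)
  (a_sum : forall n, \sum_(0 <= k < n) lambda k * `|a k| <= Sa)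
  (b_sum : forall n, \sum_(0 <= k < n) lambda k * `|b k| <= Sb)
  (yE : forall k, y k = x k - gamma k *: U k (sfp_grad L Q (x k) + b k))
  (xE : forall k, x k.+1 =
    x k + lambda k *: (metric_proj (norm_inv (U k)) C (y k) + a k - x k)).

Let N k := form_norm (inv_form (U k)).
Let fB k : semi_inner (inv_form (U k)) := semi_inner_inv_form alpha_gt0 (U_pos k).
Let T k := sfp_step L C Q (U k) (gamma k) (x k).
(** This bounds the effect of the perturbations [a k] and [b k] on the iterate, measured by
    [N k], since the projection is nonexpansive for [N k]. *)
Let err k := gamma1 * Num.sqrt mu * (lambda k * `|b k|)
  + Num.sqrt alpha^-1 * (lambda k * `|a k|).

Let gamma_gt0 k : 0 < gamma k.
Proof. by have /andP[+ _] := gamma_itv k; exact: lt_le_trans. Qed.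

Let kap_bnd k : 0 < kap k < 2.
Proof.
have /andP[h1 h2] := kap_itv k.
by rewrite (lt_le_trans kap0_gt0 h1) (le_lt_trans h2 kap1_lt2).
Qed.

Let lambda_gt0 k : 0 < lambda k.
Proof. by have /andP[+ _] := lambda_itv k; exact: lt_le_trans. Qed.

Let gamma1_ge0 : 0 <= gamma1.
Proof.
have /andP[g0 g1] := gamma_itv 0.
by rewrite ltW// (lt_le_trans gamma0_gt0)// (le_trans g0).
Qed.

Let beta_gt0 : 0 < beta.
Proof. by rewrite betaE div1r invr_gt0 exprn_gt0. Qed.

Let U_gt0 k : 0 < op_norm (U k).
Proof.
have /andP[+ _] := kap_bnd k.
by rewrite kapE pmulr_lgt0 ?invr_gt0// pmulr_rgt0.
Qed.

Let mu_gt0 : 0 < mu. Proof. exact: lt_le_trans (U_gt0 0) (U_le 0). Qed.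

Lemma sqr_norm_le_N k v : `|v| ^+ 2 <= mu * N k v ^+ 2.
Proof.
rewrite /N sqr_form_norm//.
apply: le_trans (inv_form_lower alpha_gt0 (U_pos k) v) _.
by rewrite ler_wpM2r ?U_le// (form_ge0 (fB k)).
Qed.

Lemma N_le_norm k v : N k v <= Num.sqrt alpha^-1 * `|v|.
Proof.
rewrite -[`|v|]normr_id -sqrtr_sqr -sqrtrM ?invr_ge0 ?(ltW alpha_gt0)//.
rewrite /N /form_norm ler_wsqrtr//; exact: inv_form_upper alpha_gt0 (U_pos k) v.
Qed.

Lemma N_op_le k v : N k (U k v) <= Num.sqrt mu * `|v|.
Proof.
rewrite -[`|v|]normr_id -sqrtr_sqr -sqrtrM ?(ltW mu_gt0)// /N /form_norm ler_wsqrtr//.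
rewrite (inv_form_op alpha_gt0 (U_pos k)) innerC.
apply: le_trans (posop_le (U_pos k) v) _.
by rewrite ler_wpM2r ?sqr_ge0.
Qed.

Lemma N_step k v : N k.+1 v ^+ 2 <= (1 + eta k) * N k v ^+ 2.
Proof.
rewrite /N !sqr_form_norm//.
apply: (inv_form_antitone v alpha_gt0 _ (U_pos k) (U_pos k.+1) (U_mono k)).
by rewrite addr_ge0.
Qed.

Lemma err_ge0 k : 0 <= err k.
Proof.
by rewrite addr_ge0// !mulr_ge0 ?sqrtr_ge0 ?gamma1_ge0// ltW.
Qed.

Lemma err_sum n :
  \sum_(0 <= k < n) err k <= gamma1 * Num.sqrt mu * Sb + Num.sqrt alpha^-1 * Sa.
Proof.
rewrite big_split /= -!mulr_sumr.
by apply: lerD; rewrite ler_wpM2l// mulr_ge0 ?sqrtr_ge0 ?gamma1_ge0.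
Qed.

(** The perturbation adds at most [err k] to the distance, by the triangle inequality; the
    decrease [g] of the squared distance survives outside the square because the exact step is
    no farther from [xs] than [x k]. *)
Lemma perturbed_step xs k g : sfp L C Q xs ->
  N k (x k + lambda k *: (T k - x k) - xs) ^+ 2 + g <= N k (x k - xs) ^+ 2 ->
  0 <= g ->
  N k.+1 (x k.+1 - xs) ^+ 2 <= (1 + eta k) * ((N k (x k - xs) + err k) ^+ 2 - g).
Proof.
move=> xs_sol; have [Cxs _] := xs_sol.
set v := x k + _ - xs => vg g0.
have C0 : C !=set0 by exists xs.
pose e := metric_proj (norm_inv (U k)) C (y k) - T k + a k.
have xsE : x k.+1 - xs = v + lambda k *: e.
  have eT : T k - x k + e = metric_proj (norm_inv (U k)) C (y k) + a k - x k.
    by rewrite /e [_ - T k + a k]addrAC [LHS]addrC addrA subrK.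
  by rewrite xE -eT scalerDr /v [RHS]addrAC addrA.
have e_le : lambda k * N k e <= err k.
  have Ne : N k e <= gamma k * N k (U k (b k)) + N k (a k).
    apply: le_trans (form_normD (fB k) _ _) _; rewrite lerD2r.
    apply: le_trans (norm_inv_proj_nonexpansive alpha_gt0 (U_pos k) (U_gt0 k)
      C0 C_closed C_convex _ _) _.
    have -> : y k - (x k - gamma k *: U k (sfp_grad L Q (x k)))
        = - (gamma k *: U k (b k)).
      rewrite yE linearD scalerDr [- (_ + gamma k *: U k (b k))]opprD.
      by rewrite [x k + (_ - _)]addrA [LHS]addrAC subrr add0r.
    change (N k (- (gamma k *: U k (b k))) <= gamma k * N k (U k (b k))).
    rewrite /N form_normN; last exact: fB.
    by rewrite form_normZ ?gtr0_norm//; exact: fB.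
  rewrite /err; apply: (@le_trans _ _ (lambda k * (gamma k * N k (U k (b k)) + N k (a k)))).
    by rewrite ler_pM2l.
  rewrite mulrDr; apply: lerD; last by rewrite [leRHS]mulrCA ler_pM2l ?N_le_norm.
  rewrite [leRHS]mulrCA ler_pM2l// -mulrA.
  have /andP[_ g1] := gamma_itv k.
  by apply: ler_pM => //; [exact: ltW|exact: form_norm_ge0|exact: N_op_le].
have Nx : N k (x k.+1 - xs) <= N k v + err k.
  rewrite xsE; apply: le_trans (form_normD (fB k) _ _) _.
  by rewrite form_normZ// gtr0_norm// lerD2l.
apply: le_trans (N_step _ _) _; apply: ler_wpM2l; first by rewrite addr_ge0.
have v0 : 0 <= N k v by exact: form_norm_ge0.
have x0 : 0 <= N k (x k.+1 - xs) by exact: form_norm_ge0.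
have u0 : 0 <= N k (x k - xs) by exact: form_norm_ge0.
have e0 := err_ge0 k.
have vu : N k v <= N k (x k - xs).
  by rewrite -(@ler_pXn2r _ 2) ?nnegrE//; lra.
apply: (@le_trans _ _ ((N k v + err k) ^+ 2)).
  by rewrite ler_pXn2r ?nnegrE ?(addr_ge0 v0 e0).
have : N k v * err k <= N k (x k - xs) * err k by rewrite ler_wpM2r.
by rewrite !sqrrD; lra.
Qed.

Lemma fejer_gap xs : sfp L C Q xs -> exists gap : nat -> R,
  [/\ forall k, 0 <= gap k, cvgn (fun k => N k (x k - xs)), gap @ \oo --> (0 : R),
    forall k, gamma k * sfp_residual L Q (x k) <= 2 * gap k +
      Num.sqrt (4 * kap k * gap k) * ((2 / kap k + 3 / (2 - kap k)) * N k (x k - xs)) &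
    forall k, kap k * N k (x k - T k) <=
      2 * Num.sqrt (kap k * (gamma k * sfp_residual L Q (x k)))
      + Num.sqrt (4 * kap k * gap k)].
Proof.
move=> xs_sol.
pose est k := cid2 (sfp_step_estimates L_bounded L_gt0 betaE
  C_closed C_convex Q_closed Q_convex (x k) alpha_gt0 (U_pos k) (gamma_gt0 k) (kapE k)
  (kap_bnd k) xs_sol).
pose gap k := s2val (est k).
have gap0 k : 0 <= gap k by exact: (s2valP (est k)).
have step k lam : 0 <= lam <= 2 - kap k / 2 ->
  N k (x k + lam *: (T k - x k) - xs) ^+ 2 + 2 * lam * gap k <= N k (x k - xs) ^+ 2.
  by have [+ _ _] := s2valP' (est k); exact.
have lgap0 k : 0 <= 2 * lambda k * gap k by rewrite !mulr_ge0// ltW.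
have u0 k : 0 <= N k (x k - xs) by exact: form_norm_ge0.
have [|ucvg lgap] := quasi_fejer_gap u0 eta_ge0 err_ge0 lgap0 eta_sum err_sum.
  move=> k; apply: perturbed_step => //; apply: step.
  by have /andP[_ ->] := lambda_itv k; rewrite ltW.
exists gap; split=> //.
- apply: squeeze0_cvg (cvg0_cstM (2 * lambda0)^-1 lgap) => k.
  rewrite gap0 ler_pdivlMl ?mulr_gt0//= ler_wpM2r// ler_pM2l//.
  by have /andP[] := lambda_itv k.
- by move=> k; have [_ + _] := s2valP' (est k).
- by move=> k; have [_ _ +] := s2valP' (est k).
Qed.

Lemma distance_cvg xs : sfp L C Q xs -> cvgn (fun k => N k (x k - xs)).
Proof. by move=> /fejer_gap[gap []]. Qed.

Lemma distance_bounded xs : sfp L C Q xs -> exists M, forall k, N k (x k - xs) <= M.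
Proof.
move=> /distance_cvg/cvg_seq_bounded[M [Mr MP]].
exists (M + 1) => k; apply: le_trans (ler_norm _) _.
by apply: (MP (M + 1)) => //; rewrite ltrDl.
Qed.

Lemma norm_le_N k v : `|v| <= Num.sqrt mu * N k v.
Proof.
rewrite -(@ler_pXn2r _ 2) ?nnegrE//; last by rewrite mulr_ge0 ?sqrtr_ge0.
by rewrite exprMn sqr_sqrtr ?(ltW mu_gt0)// sqr_norm_le_N.
Qed.

Lemma iterate_bounded : exists M, forall k, `|x k| <= M.
Proof.
have [xs xs_sol] := sfp_neq0; have [M uM] := distance_bounded xs_sol.
exists (Num.sqrt mu * M + `|xs|) => k.
rewrite -{1}(subrK xs (x k)); apply: le_trans (ler_normD _ _) _.
rewrite lerD2r; apply: le_trans (norm_le_N k _) _.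
by rewrite ler_wpM2l ?sqrtr_ge0.
Qed.

Lemma residuals_cvg0 :
  gamma k * sfp_residual L Q (x k) @[k --> \oo] --> (0 : R) /\
  `|x k - T k| @[k --> \oo] --> (0 : R).
Proof.
have [xs xs_sol] := sfp_neq0; have [M uM] := distance_bounded xs_sol.
have [gap [gap0 _ gap_cvg res_le dist_le]] := fejer_gap xs_sol.
have k0 k : 0 < kap k by have /andP[] := kap_bnd k.
have k2 k : kap k < 2 by have /andP[] := kap_bnd k.
have g8 : Num.sqrt (8 * gap k) @[k --> \oo] --> (0 : R).
  by apply: cvg0_sqrt; exact: cvg0_cstM.
have g8_le k : Num.sqrt (4 * kap k * gap k) <= Num.sqrt (8 * gap k).
  by rewrite ler_wsqrtr// ler_wpM2r//; have := k2 k; lra.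
have res0 k : 0 <= gamma k * sfp_residual L Q (x k).
  by rewrite mulr_ge0 ?sqr_ge0// ltW.
have M0 : 0 <= M by apply: le_trans (uM 0); exact: form_norm_ge0.
pose K := (2 / kap0 + 3 / (2 - kap1)) * M.
have res_cvg : gamma k * sfp_residual L Q (x k) @[k --> \oo] --> (0 : R).
  apply: squeeze0_cvg (cvg0D (cvg0_cstM 2 gap_cvg) (cvg0_cstM K g8)) => k.
  rewrite res0 /=; apply: le_trans (res_le k) _; rewrite lerD2l [leRHS]mulrC.
  have /andP[kl ku] := kap_itv k.
  have c0 : 0 <= 2 / kap k + 3 / (2 - kap k).
    by rewrite addr_ge0 ?divr_ge0 ?subr_ge0 ?(ltW (k0 k)) ?(ltW (k2 k)).
  apply: ler_pM => //; first by rewrite mulr_ge0 ?form_norm_ge0.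
  apply: ler_pM => //; first exact: form_norm_ge0.
  apply: lerD; rewrite ler_pM2l// lef_pV2 ?posrE ?subr_gt0//.
  by rewrite lerD2l lerN2.
split=> //.
have lim : kap0^-1 * (2 * Num.sqrt (2 * (gamma k * sfp_residual L Q (x k)))
    + Num.sqrt (8 * gap k)) @[k --> \oo] --> (0 : R).
  apply: cvg0_cstM; apply: cvg0D => //; apply: cvg0_cstM; apply: cvg0_sqrt.
  exact: cvg0_cstM.
apply: squeeze0_cvg (cvg0_cstM (Num.sqrt mu) lim) => k; rewrite normr_ge0 /=.
apply: le_trans (norm_le_N k _) _; rewrite ler_wpM2l ?sqrtr_ge0// ler_pdivlMl//.
have /andP[kl _] := kap_itv k.
apply: (@le_trans _ _ (kap k * N k (x k - T k))).
  by rewrite ler_wpM2r ?form_norm_ge0.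
apply: le_trans (dist_le k) _; apply: lerD => //; rewrite ler_pM2l//.
by rewrite ler_wsqrtr// ler_wpM2r// ltW.
Qed.

Lemma residual_cvg0 : sfp_residual L Q (x k) @[k --> \oo] --> (0 : R).
Proof.
have [res _] := residuals_cvg0.
apply: squeeze0_cvg (cvg0_cstM gamma0^-1 res) => k.
rewrite sqr_ge0 ler_pdivlMl//= ler_wpM2r ?sqr_ge0//.
by have /andP[] := gamma_itv k.
Qed.

Lemma grad_cvg0 : sfp_grad L Q (x k) @[k --> \oo] --> (0 : H).
Proof.
apply: norm_cvg0; apply: squeeze0_cvg (cvg0_sqrt (cvg0_cstM beta^-1 residual_cvg0)) => k.
rewrite normr_ge0 /= -[leLHS]normr_id -sqrtr_sqr ler_wsqrtr// ler_pdivlMl//.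
exact: sfp_grad_le.
Qed.

(** By the vanishing residuals, [T k] and the projections of [L (x k)] onto [Q] have the same
    weak limits as [x k] and [L (x k)]; they lie in [C] and [Q]. *)
Lemma weak_cluster_solution F p : UltraFilter F -> \oo `<=` F ->
  (forall v, inner (x k) v @[k --> F] --> inner p v) -> sfp L C Q p.
Proof.
move=> FU Foo xp; have [xs [Cxs Qxs]] := sfp_neq0.
have [_ dist] := residuals_cvg0.
have diffF (W : hilbertType R) (f : nat -> W) v :
    `|f k| @[k --> \oo] --> (0 : R) -> inner (f k) v @[k --> F] --> (0 : R).
  move=> /norm_cvg0 f0; have f0F : f @ F --> (0 : W) by move=> P /f0; exact: Foo.
  by rewrite -(form0l (semi_inner_inner W) v); exact: inner_cvgl.
split.
- apply: (weak_limit_closed_convex (F := F) (x := T)) => //.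
    move=> k; have C0 : C !=set0 by exists xs.
    by have [] := norm_inv_proj_variational alpha_gt0 (U_pos k) (U_gt0 k) C0 C_closed C_convex
      (x k - gamma k *: U k (sfp_grad L Q (x k))).
  move=> v; rewrite -[X in _ --> X]subr0.
  have -> : (fun k => inner (T k) v) = (fun k => inner (x k) v - inner (x k - T k) v).
    apply/funext => k.
    by rewrite (formDl (semi_inner_inner H)) (formNl (semi_inner_inner H)) opprB addrC subrK.
  by apply: cvgB => //; exact: diffF.
- apply: (weak_limit_closed_convex (F := F) (x := fun k => metric_proj Num.norm Q (L (x k)))) => //.
    by move=> k; have [] := norm_proj_variational (L (x k)) (ex_intro _ _ Qxs) Q_closed Q_convex.
  move=> v; rewrite adjointP// -[X in _ --> X]subr0.
  have -> : (fun k => inner (metric_proj Num.norm Q (L (x k))) v)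
    = (fun k => inner (x k) (adjoint L v)
        - inner (L (x k) - metric_proj Num.norm Q (L (x k))) v).
    apply/funext => k; rewrite -adjointP//.
    by rewrite (formDl (semi_inner_inner G)) (formNl (semi_inner_inner G)) opprB addrC subrK.
  apply: cvgB => //; apply: diffF.
  have := cvg0_sqrt residual_cvg0; apply: cvg_trans; apply: near_eq_cvg; apply: nearW => k /=.
  by rewrite /sfp_residual sqrtr_sqr normr_id.
Qed.

Lemma iterate_weak_cvg : exists2 xs, sfp L C Q xs & weak_cvg x xs.
Proof.
have [M xM] := iterate_bounded.
apply: (variable_metric_opial (A := fun k => op_inv (U k)) (mu := mu) (M := M)) => //.
- move=> k u; have := sqr_norm_le_N k u; rewrite /N sqr_form_norm//; exact: fB.
- apply: (antitone_form_cvg eta_ge0 eta_sum (K := alpha^-1)) => [k|k u|k u].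
  + exact: fB.
  + exact: inv_form_upper (U_pos k) u.
  + by have := N_step k u; rewrite /N !sqr_form_norm//; exact: fB.
- move=> z /distance_cvg ucvg.
  have -> : (fun k => inner (op_inv (U k) (x k - z)) (x k - z))
      = (fun k => N k (x k - z) * N k (x k - z)).
    by apply/funext => k; rewrite -expr2 /N sqr_form_norm//; exact: fB.
  exact: is_cvgM.
- exact: weak_cluster_solution.
Qed.

Lemma sfp_iteration_convergence :
  [/\ (forall xs, sfp L C Q xs -> cvgn (fun k => norm_inv (U k) (x k - xs))),
      `|x k - metric_proj (norm_inv (U k)) C
                (x k - gamma k *: U k (sfp_grad L Q (x k)))|
        @[k --> \oo] --> (0 : R),
      (exists2 xs, sfp L C Q xs & weak_cvg x xs) &
      (forall xs, sfp L C Q xs ->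
        sfp_grad L Q (x k) @[k --> \oo] --> sfp_grad L Q xs)].
Proof.
split.
- exact: distance_cvg.
- by have [_] := residuals_cvg0.
- exact: iterate_weak_cvg.
- by move=> xs /(sfp_grad_solution L_bounded Q_closed Q_convex) ->; exact: grad_cvg0.
Qed.

End Convergence.

Theorem theorem4p3 (R : realType) (H G : hilbertType R)
    (L : {linear H -> G}) (C : set H) (Q : set G)
    (beta alpha mu : R) (eta gamma lambda alpha_ : nat -> R)
    (U : nat -> {linear H -> H}) (a b x y : nat -> H)
    (L_bounded : bounded_fun_norm L) (L_neq0 : exists x, L x != 0)
    (C_neq0 : C !=set0) (C_closed : closed C) (C_convex : convex_set C)
    (Q_neq0 : Q !=set0) (Q_closed : closed Q) (Q_convex : convex_set Q)
    (betaE : beta = 1 / op_norm L ^+ 2)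
    (sfp_neq0 : sfp L C Q !=set0)
    (alpha_gt0 : 0 < alpha)
    (eta_l1 : l1_plus eta)
    (U_pos : forall k, posop alpha (U k))
    (U_ubound : has_ubound (range (fun k => op_norm (U k))))
    (muE : mu = sup (range (fun k => op_norm (U k))))
    (U_mono : forall k,
      loewner_le (U k) (fun z => (1 + eta k) *: U k.+1 z))
    (gamma_itv : forall k, 0 < gamma k < 2 * beta / op_norm (U k))
    (alpha_E : forall k,
      alpha_ k = 2 * beta / (4 * beta - gamma k * op_norm (U k)))
    (lambda_itv : forall k, 0 < lambda k < 1 / alpha_ k)
    (a_sum : (\sum_(0 <= k <oo) (lambda k * `|a k|)%:E < +oo)%E)
    (b_sum : (\sum_(0 <= k <oo) (lambda k * `|b k|)%:E < +oo)%E)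
    (cond_AB :
      (* (A) *)
      (exists lambda0 tau gamma0 eps : R,
        [/\ 0 < lambda0,
            (forall k, 0 < tau < 1 / alpha_ k - lambda0),
            (forall k, lambda0 <= lambda k <= 1 / alpha_ k - tau),
            0 < gamma0 /\ 0 < eps < 2 * beta - mu * gamma0 &
            forall k, gamma0 <= gamma k <= (2 * beta - eps) / mu])
      \/
      (* (B) *)
      (exists lambda0 gamma0 eps : R,
        [/\ (\sum_(0 <= k <oo)
               (lambda k * (1 / alpha_ k - lambda k))%:E = +oo)%E,
            [/\ 0 < gamma0, 0 < eps < 2 * beta - mu * gamma0 &
              forall k, gamma0 <= gamma k <= (2 * beta - eps) / mu],
            (\sum_(0 <= k <oo) `|gamma k.+1 - gamma k|%:E < +oo)%E /\
            (\sum_(0 <= k <oo)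
               `|gamma k.+1 * op_norm (U k.+1) - gamma k * op_norm (U k)|%:E
             < +oo)%E,
            (forall z : H, (\sum_(0 <= k <oo)
               `|op_inv (U k) z - op_inv (U k.+1) z|%:E < +oo)%E) &
            0 < lambda0 /\ forall k, lambda0 <= lambda k]))
    (yE : forall k, y k = x k - gamma k *: U k (sfp_grad L Q (x k) + b k))
    (xE : forall k, x k.+1 =
      x k + lambda k *: (metric_proj (norm_inv (U k)) C (y k) + a k - x k)) :
  [/\ (* (i) *)
      (forall xs, sfp L C Q xs -> cvgn (fun k => norm_inv (U k) (x k - xs))),
      (* (ii) *)
      `|x k - metric_proj (norm_inv (U k)) C
                (x k - gamma k *: U k (sfp_grad L Q (x k)))|
        @[k --> \oo] --> (0 : R),
      (* (iii) *)
      (exists2 xs, sfp L C Q xs & weak_cvg x xs) &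
      (* (iv) *)
      (forall xs, sfp L C Q xs ->
        sfp_grad L Q (x k) @[k --> \oo] --> sfp_grad L Q xs)].
Proof.
have [h0 Lh0] := L_neq0.
have h0_gt0 : 0 < `|h0|.
  by rewrite normr_gt0; apply: contraNneq Lh0 => ->; rewrite linear0.
have L_gt0 : 0 < op_norm L.
  rewrite -(pmulr_lgt0 _ h0_gt0); apply: lt_le_trans (le_op_norm _ L_bounded).
  by rewrite normr_gt0.
have beta_gt0 : 0 < beta by rewrite betaE div1r invr_gt0 exprn_gt0.
have U_ge k : alpha <= op_norm (U k).
  rewrite -(@ler_pM2r _ (`|h0| ^+ 2)) ?exprn_gt0//.
  exact: le_trans (posop_ge (U_pos k) h0) (posop_le (U_pos k) h0).
have U_le k : op_norm (U k) <= mu by rewrite muE; apply: ub_le_sup => //; exists k.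
have mu_gt0 : 0 < mu := lt_le_trans alpha_gt0 (le_trans (U_ge 0) (U_le 0)).
pose kap k := gamma k * op_norm (U k) / beta.
have alphaE k : 1 / alpha_ k = 2 - kap k / 2.
  rewrite alpha_E div1r invf_div /kap; field; exact: lt0r_neq0.
have [lambda0 [gamma0 [eps [lambda0_gt0 lambda_ge gamma0_gt0 eps_gt0 gamma_itv0]]]] :
    exists lambda0 gamma0 eps : R, [/\ 0 < lambda0, forall k, lambda0 <= lambda k,
      0 < gamma0, 0 < eps & forall k, gamma0 <= gamma k <= (2 * beta - eps) / mu].
  case: cond_AB => [[l0 [tau [g0 [e [l0p _ lP [g0p /andP[ep _]] gP]]]]]|
                    [l0 [g0 [e [_ [g0p /andP[ep _] gP] _ _ [l0p lP]]]]]].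
    by exists l0, g0, e; split=> // k; have /andP[] := lP k.
  by exists l0, g0, e.
have kap_itv k : gamma0 * alpha / beta <= kap k <= 2 - eps / beta.
  have /andP[g1 g2] := gamma_itv0 k; apply/andP; split.
    by rewrite ler_pM2r ?invr_gt0//; apply: ler_pM => //; exact: ltW.
  have -> : 2 - eps / beta = (2 * beta - eps) / beta by field; exact: lt0r_neq0.
  rewrite ler_pM2r ?invr_gt0//; apply: (@le_trans _ _ (gamma k * mu)).
    by rewrite ler_pM2l// (lt_le_trans gamma0_gt0).
  by rewrite -ler_pdivlMr.
have [eta_ge0 /(nneseries_psum_bounded eta_ge0)[S eta_sum]] := eta_l1.
have lambda_gt0 k : 0 < lambda k by have /andP[] := lambda_itv k.
have lambda_itv' k : lambda0 <= lambda k <= 2 - kap k / 2.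
  by rewrite lambda_ge -alphaE ltW//; have /andP[] := lambda_itv k.
have [|Sa {}a_sum] := nneseries_psum_bounded _ a_sum.
  by move=> k; rewrite mulr_ge0// ltW.
have [|Sb {}b_sum] := nneseries_psum_bounded _ b_sum.
  by move=> k; rewrite mulr_ge0// ltW.
have kap0_gt0 : 0 < gamma0 * alpha / beta by rewrite divr_gt0// mulr_gt0.
have kap1_lt2 : 2 - eps / beta < 2 by rewrite gtrBl divr_gt0.
have kapE k : kap k = gamma k * op_norm (U k) / beta by [].
exact: (sfp_iteration_convergence L_bounded L_gt0 C_closed C_convex Q_closed Q_convex betaE
  sfp_neq0 alpha_gt0 eta_ge0 eta_sum U_pos U_le U_mono gamma0_gt0 gamma_itv0 kapE kap0_gt0
  kap1_lt2 kap_itv lambda0_gt0 lambda_itv' a_sum b_sum yE xE).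
Qed.
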